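(* Let $x:M\to\mathbf{E}_1^3$ be a constant angle spacelike surface (with hyperbolic angle $\theta>0$ between the future-directed unit normal $\xi$ and the fixed direction $U$) whose second fundamental form vanishes at no point. Then, up to a rigid motion (isometry) of $\mathbf{E}_1^3$ after which $U=(0,0,1)$, around each point of $M$ there exist local coordinates $(u,v)$ in which $M$ is given by the parametrization $$x(u,v)=\Big(u\cosh(\theta)\big(\cos v,\sin v\big)+\psi(v),\,-u\sinh(\theta)\Big),$$ where $$\psi(v)=\sinh(\theta)\Big(\int\alpha(v)\sin v\,dv,\;-\int\alpha(v)\cos v\,dv\Big),$$ the integrals denoting antiderivatives, and where $\alpha$ is a smooth function on a certain interval $I$. Here $\theta$ is the hyperbolic angle between the unit normal of $M$ and the fixed direction $U=(0,0,1)$.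
   Context: $\mathbf{E}_1^3$ is $\mathbb{R}^3$ with the Lorentzian metric $\langle\,,\rangle=dx_1^2+dx_2^2-dx_3^2$; points are written as $(p,z)$ with $p\in\mathbb{R}^2$, $z\in\mathbb{R}$. A vector $w$ is timelike if $\langle w,w\rangle<0$, and $|w|=\sqrt{|\langle w,w\rangle|}$. A timelike vector $w$ is future-directed if $\langle w,(0,0,1)\rangle<0$. For timelike $a,b$ in the same timelike cone ($\langle a,b\rangle<0$) the hyperbolic angle is the unique $\theta\ge 0$ with $\langle a,b\rangle=-|a||b|\cosh\theta$. A smooth immersion $x:M\to\mathbf{E}_1^3$ of a connected surface is spacelike if the induced metric is Riemannian; equivalently its unit normal fields are timelike. The unit normal field $\xi$ is chosen future-directed. $M$ is a constant angle (spacelike) surface if there is a fixed timelike vector $U$ (taken unit and future-directed) such that $\xi$ makes a constant hyperbolic angle $\theta$ with $U$. *)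

(* Defs.v *)
From HB Require Import structures.
From mathcomp Require Import all_boot all_order all_algebra.
From mathcomp Require Import all_classical all_reals all_analysis.

Set Implicit Arguments.
Unset Strict Implicit.
Unset Printing Implicit Defensive.

Import Order.TTheory GRing.Theory Num.Theory.
Import numFieldNormedType.Exports.

Local Open Scope classical_set_scope.
Local Open Scope ring_scope.

(** ** Smoothness on open sets of normed spaces *)

(* Intended for [D] open and [V] of finite dimension, where the Fréchet
   derivative of [f] is C^k iff all the directional derivatives are. *)
Fixpoint Ck_on (R : realType) (V W : normedModType R) (k : nat)
    (f : V -> W) (D : set V) : Prop :=
  if k is k'.+1 then
    (forall q, D q -> differentiable f q) /\
    (forall v : V, Ck_on k' (fun q => 'D_v f q) D)
  else {in D, continuous f}.

Definition smooth_on (R : realType) (V W : normedModType R)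
    (f : V -> W) (D : set V) : Prop :=
  forall k, Ck_on k f D.

(** ** Smooth surfaces *)

(* A homeomorphism from an open set of [M] onto an open set of R^2; the
   values of the two maps outside these open sets are irrelevant. *)
Record chart (R : realType) (M : topologicalType) := Chart {
  chart_dom : set M;
  chart_cod : set 'rV[R]_2;
  chart_map : M -> 'rV[R]_2;
  chart_inv : 'rV[R]_2 -> M;
  chart_dom_open : open chart_dom;
  chart_cod_open : open chart_cod;
  chart_map_cod : forall p, chart_dom p -> chart_cod (chart_map p);
  chart_inv_dom : forall q, chart_cod q -> chart_dom (chart_inv q);
  chart_mapK : forall p, chart_dom p -> chart_inv (chart_map p) = p;
  chart_invK : forall q, chart_cod q -> chart_map (chart_inv q) = q;
  chart_map_continuous : {in chart_dom, continuous chart_map};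
  chart_inv_continuous : {in chart_cod, continuous chart_inv} }.

Definition smooth_transition (R : realType) (M : topologicalType)
    (c d : chart R M) : Prop :=
  smooth_on (chart_map d \o chart_inv c)
            (chart_cod c `&` chart_inv c @^-1` chart_dom d).

Definition compatible (R : realType) (M : topologicalType)
    (c d : chart R M) : Prop :=
  smooth_transition c d /\ smooth_transition d c.

Definition smooth_surface (R : realType) (M : topologicalType)
    (atlas : set (chart R M)) : Prop :=
  [/\ hausdorff_space M,
      @second_countable M,
      forall p : M, exists2 c, atlas c & chart_dom c p
    & forall c d, atlas c -> atlas d -> compatible c d].

Definition maximal_atlas (R : realType) (M : topologicalType)
    (atlas : set (chart R M)) : set (chart R M) :=
  [set c | forall d, atlas d -> compatible c d].

Definition smooth_map (R : realType) (M : topologicalType)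
    (atlas : set (chart R M)) (W : normedModType R) (f : M -> W) : Prop :=
  forall c, atlas c -> smooth_on (f \o chart_inv c) (chart_cod c).

(** ** Lorentz-Minkowski space *)

Definition lorentz (R : realType) (a b : 'rV[R]_3) : R :=
  a 0 0 * b 0 0 + a 0 1 * b 0 1 - a 0 ord_max * b 0 ord_max.

Definition timelike (R : realType) (w : 'rV[R]_3) : Prop := lorentz w w < 0.

Definition lorentz_norm (R : realType) (w : 'rV[R]_3) : R :=
  Num.sqrt `|lorentz w w|.

Definition vec2 (R : realType) (a b : R) : 'rV[R]_2 :=
  \row_j (if j == 0 then a else b).

(* The point written (p, z). *)
Definition pt (R : realType) (p : 'rV[R]_2) (z : R) : 'rV[R]_3 :=
  row_mx p (z%:M : 'rV[R]_1).

Definition future_directed (R : realType) (w : 'rV[R]_3) : Prop :=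
  timelike w /\ lorentz w (pt 0 1) < 0.

Definition coshR (R : realType) (t : R) : R := (expR t + expR (- t)) / 2.
Definition sinhR (R : realType) (t : R) : R := (expR t - expR (- t)) / 2.

Definition hyperbolic_angle (R : realType) (a b : 'rV[R]_3) (theta : R) : Prop :=
  [/\ timelike a, timelike b, lorentz a b < 0, 0 <= theta
    & lorentz a b = - (lorentz_norm a * lorentz_norm b * coshR theta)].

Definition lorentz_linear_isometry (R : realType) (A : 'M[R]_3) : Prop :=
  forall a b : 'rV[R]_3, lorentz (a *m A) (b *m A) = lorentz a b.

(** ** Spacelike surfaces *)

Definition immersion (R : realType) (M : topologicalType)
    (atlas : set (chart R M)) (x : M -> 'rV[R]_3) : Prop :=
  smooth_map atlas x /\
  forall c, atlas c -> forall q, chart_cod c q ->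
  forall v, 'D_v (x \o chart_inv c) q = 0 -> v = 0.

Definition spacelike (R : realType) (M : topologicalType)
    (atlas : set (chart R M)) (x : M -> 'rV[R]_3) : Prop :=
  forall c, atlas c -> forall q, chart_cod c q -> forall v, v != 0 ->
  0 < lorentz ('D_v (x \o chart_inv c) q) ('D_v (x \o chart_inv c) q).

Definition future_unit_normal (R : realType) (M : topologicalType)
    (atlas : set (chart R M)) (x xi : M -> 'rV[R]_3) : Prop :=
  [/\ smooth_map atlas xi,
      forall c, atlas c -> forall q, chart_cod c q -> forall v,
        lorentz ('D_v (x \o chart_inv c) q) (xi (chart_inv c q)) = 0,
      forall p, lorentz (xi p) (xi p) = -1
    & forall p, future_directed (xi p)].

Definition constant_angle (R : realType) (M : topologicalType)
    (xi : M -> 'rV[R]_3) (U : 'rV[R]_3) (theta : R) : Prop :=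
  forall p, hyperbolic_angle (xi p) U theta.

(* The normal component of the second derivative of the immersion, read in the
   chart [c] at the coordinates [q]; the normal component of a vector [w] is
   [- <w, xi> xi] because [<xi, xi> = -1]. *)
Definition second_fundamental_form (R : realType) (M : topologicalType)
    (x xi : M -> 'rV[R]_3) (c : chart R M) (q v w : 'rV[R]_2) : 'rV[R]_3 :=
  - lorentz ('D_v (fun r => 'D_w (x \o chart_inv c) r) q) (xi (chart_inv c q))
    *: xi (chart_inv c q).

Definition second_fundamental_form_nowhere_zero (R : realType)
    (M : topologicalType) (atlas : set (chart R M))
    (x xi : M -> 'rV[R]_3) : Prop :=
  forall c, atlas c -> forall q, chart_cod c q ->
  exists v w, second_fundamental_form x xi c q v w != 0.

(** ** The model parametrization *)

(* [S] and [C] stand for antiderivatives of [alpha * sin] and [alpha * cos]. *)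
Definition psi (R : realType) (theta : R) (S C : R -> R) (v : R) : 'rV[R]_2 :=
  sinhR theta *: vec2 (S v) (- C v).

Definition constant_angle_param (R : realType) (theta : R) (S C : R -> R)
    (u v : R) : 'rV[R]_3 :=
  pt ((u * coshR theta) *: vec2 (cos v) (sin v) + psi theta S C v)
     (- u * sinhR theta).

(* Main.v *)
Require Import Defs.
From HB Require Import structures.
From mathcomp Require Import all_boot all_order all_algebra.
From mathcomp Require Import all_classical all_reals all_analysis.
From mathcomp Require Import ring lra.

Import Order.TTheory GRing.Theory Num.Theory.
Import numFieldNormedType.Exports.

Local Open Scope classical_set_scope.
Local Open Scope ring_scope.

Set Implicit Arguments.
Unset Strict Implicit.
Unset Printing Implicit Defensive.

(* Let phi be the angle of the horizontal part of - xi and u = - z / sinh(theta),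
   where z is the height after a Lorentz isometry taking U to (0,0,1). Writing
   e = (cos phi, sin phi, 0) and e' = (- sin phi, cos phi, 0), one has
   xi = - sinh(theta) e + cosh(theta) (0,0,1), and orthogonality of xi to the
   surface gives
     dx = (cosh(theta) e - sinh(theta) (0,0,1)) du + lambda e'
   for some 1-form lambda. The second fundamental form is a multiple of
   dphi (x) lambda; since it is symmetric and nonzero, lambda is a multiple of
   dphi and dphi is nonzero, so (u, phi) is a local coordinate system by
   injectivity of dx. In it x is affine in u, with velocity
   cosh(theta) e - sinh(theta) (0,0,1), and the remaining term depends on phi
   only and has derivative along e'. *)

(** * Calculus of C^k maps *)

(** Differentiating <dx(b), xi> = 0 along a, with dxi = - sinh(theta) dphi e', gives <D_a D_b x, xi>
    = sinh(theta) dphi(a) lambda(b); this is how the second fundamental form becomes a product. That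
    lambda is a multiple of dphi is used in the form: lambda vanishes on the kernel of dphi.
    Integration in u needs a domain in which every point is joined to a fixed slice u = u0 at
    constant phi. The inverse function theorem is therefore stated with a ball as target: rows carry
    the maximum norm, so a ball in the plane is a square, and its second coordinates fill an open
    interval. On that slice the surface has velocity lambda(d/dphi) e', while the model has (u0
    cosh(theta) - alpha sinh(theta)) e'; equating the two defines alpha. *)

Lemma CkSP (R : realType) (V W : normedModType R) k (f : V -> W) D : Ck_on k.+1 f D <->
  (forall q, D q -> differentiable f q) /\ (forall v, Ck_on k ('D_v f) D).
Proof. by []. Qed.

Section Ck.
Context {R : realType} {V : normedModType R}.

Lemma cvg_shift0 (y : V) : (fun h : V => h + y) @ (0 : V) --> y.
Proof.
by rewrite -[X in _ --> X](add0r y); apply: cvgD; [exact: cvg_id|exact: cvg_cst].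
Qed.

(** The first-order expansion at [q] involves only values near [q], so ['d f q] serves for [g]
    too. *)
Lemma near_eq_differentiable (W : normedModType R) (f g : V -> W) (q : V) :
  (\near q, f q = g q) -> differentiable f q -> differentiable g q.
Proof.
move=> fg /diff_locallyP[dc df].
have gE : \forall h \near (0 : V), f (h + q) = g (h + q).
  exact: (cvg_shift0 fg).
have dg : g \o shift q = cst (g q) + 'd f q +o_ 0 id.
  apply/eqaddoP => _/posnumP[e].
  move/eqaddoP : df => /(_ e%:num (gt0 e)) df.
  near=> h; rewrite !fctE /= -(nbhs_singleton fg).
  have -> : g (h + q) = f (h + q) by symmetry; near: h.
  by near: h.
by apply/diff_locallyP; rewrite (diff_unique dc dg).
Unshelve. all: by end_near. Qed.

Lemma CkS (W : normedModType R) k (f : V -> W) D : Ck_on k.+1 f D -> Ck_on k f D.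
Proof.
elim: k f => [|k IH] f [df Df].
  by move=> q /set_mem Dq; apply: differentiable_continuous; exact: df.
by split=> // v; apply: IH.
Qed.

Lemma Ck_sub (W : normedModType R) k (f : V -> W) D E : E `<=` D -> Ck_on k f D -> Ck_on k f E.
Proof.
move=> ED; elim: k f => [|k IH] f.
  by move=> cf q /set_mem/ED Dq; apply: cf; rewrite inE.
by move=> /CkSP[df Df]; apply/CkSP; split=> [q /ED/df//|v]; apply: IH; exact: Df.
Qed.

(** Openness of [D] turns agreement on [D] into agreement near each of its points, so the
    derivatives agree as well. Derivative rules, being pointwise identities on [D], enter the
    inductions on [k] through this lemma. *)
Lemma Ck_ext (W : normedModType R) k (f g : V -> W) D : open D ->
  (forall q, D q -> f q = g q) -> Ck_on k f D -> Ck_on k g D.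
Proof.
move=> oD; elim: k f g => [|k IH] f g fg.
  move=> cf q qD; have := cf q qD; have Dq := set_mem qD.
  move=> /= c; apply: cvg_trans; last by rewrite -(fg q Dq); exact: c.
  apply: near_eq_cvg; near=> r; apply: fg; near: r; exact: open_nbhs_nbhs.
have nfg q : D q -> \near q, f q = g q.
  by move=> Dq; near=> r; apply: fg; near: r; exact: open_nbhs_nbhs.
move=> /CkSP[df Df]; apply/CkSP; split=> [q Dq|v].
  by apply: near_eq_differentiable (df q Dq); exact: nfg.
by apply: IH (Df v) => q Dq; apply: near_eq_derive; exact: nfg.
Unshelve. all: by end_near. Qed.

Lemma Ck_cst (W : normedModType R) k (a : W) D : Ck_on k (fun _ : V => a) D.
Proof.
elim: k a => [|k IH] a; first by move=> q _; exact: cvg_cst.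
apply/CkSP; split=> [q _|v]; first exact: differentiable_cst.
have -> : (fun q => 'D_v (fun=> a) q) = (fun=> 0) by apply/funext => q; rewrite derive_cst.
exact: IH.
Qed.

Lemma CkD (W : normedModType R) k (f g : V -> W) D : open D ->
  Ck_on k f D -> Ck_on k g D -> Ck_on k (fun q => f q + g q) D.
Proof.
move=> oD; elim: k f g => [|k IH] f g.
  by move=> cf cg q Dq; apply: cvgD; [exact: cf|exact: cg].
move=> /CkSP[df Df] /CkSP[dg Dg]; apply/CkSP; split=> [q Dq|v].
  by apply: differentiableD; [exact: df|exact: dg].
apply: Ck_ext (IH _ _ (Df v) (Dg v)) => // q Dq.
by rewrite -deriveD//; apply: diff_derivable; [exact: df|exact: dg].
Qed.

(** The Leibniz rule writes a derivative of the product as a sum of products; [CkS] lowers the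
    undifferentiated factors to the order of the induction hypothesis. *)
Lemma CkM k (f g : V -> R) D : open D ->
  Ck_on k f D -> Ck_on k g D -> Ck_on k (fun q => f q * g q) D.
Proof.
move=> oD; elim: k f g => [|k IH] f g.
  by move=> cf cg q Dq; apply: cvgM; [exact: cf|exact: cg].
move=> Cf Cg; have /CkSP[df Df] := Cf; have /CkSP[dg Dg] := Cg; apply/CkSP; split=> [q Dq|v].
  by apply: differentiableM; [exact: df|exact: dg].
apply: Ck_ext (CkD oD (IH _ _ (CkS Cf) (Dg v)) (IH _ _ (CkS Cg) (Df v))) => // q Dq.
by rewrite (@deriveM _ _ f g)//; apply: diff_derivable; [exact: df|exact: dg].
Qed.

Lemma CkN k (f : V -> R) D : open D -> Ck_on k f D -> Ck_on k (fun q => - f q) D.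
Proof.
move=> oD Cf; apply: Ck_ext (CkM oD (Ck_cst k (-1 : R) D) Cf) => // q _.
by rewrite mulN1r.
Qed.

Lemma CkB k (f g : V -> R) D : open D ->
  Ck_on k f D -> Ck_on k g D -> Ck_on k (fun q => f q - g q) D.
Proof. by move=> oD Cf Cg; apply: CkD => //; exact: CkN. Qed.

Lemma Ck_sum k (I : Type) (r : seq I) (P : pred I) (f : I -> V -> R) D : open D ->
  (forall i, Ck_on k (f i) D) -> Ck_on k (fun q => \sum_(i <- r | P i) f i q) D.
Proof.
move=> oD Cf; elim: r => [|i r IH].
  by apply: Ck_ext (Ck_cst k (0 : R) D) => // q _; rewrite big_nil.
case Pi: (P i); last by apply: Ck_ext IH => // q _; rewrite big_cons Pi.
by apply: Ck_ext (CkD oD (Cf i) IH) => // q _; rewrite big_cons Pi.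
Qed.

Lemma Ck_prod k (I : Type) (r : seq I) (P : pred I) (f : I -> V -> R) D : open D ->
  (forall i, Ck_on k (f i) D) -> Ck_on k (fun q => \prod_(i <- r | P i) f i q) D.
Proof.
move=> oD Cf; elim: r => [|i r IH].
  by apply: Ck_ext (Ck_cst k (1 : R) D) => // q _; rewrite big_nil.
case Pi: (P i); last by apply: Ck_ext IH => // q _; rewrite big_cons Pi.
by apply: Ck_ext (CkM oD (Cf i) IH) => // q _; rewrite big_cons Pi.
Qed.

Lemma derive_linear_comp (W Z : normedModType R) (L : {linear W -> Z}) (f : V -> W) (q v : V) :
  continuous L -> differentiable f q -> 'D_v (fun q => L (f q)) q = L ('D_v f q).
Proof.
move=> cL df; have dL : differentiable L (f q) by exact: linear_differentiable.
rewrite deriveE; last exact: differentiable_comp.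
by rewrite diff_comp//= diff_lin// deriveE.
Qed.

Lemma Ck_linear_comp (W Z : normedModType R) k (L : {linear W -> Z}) (f : V -> W) D :
  open D -> continuous L -> Ck_on k f D -> Ck_on k (fun q => L (f q)) D.
Proof.
move=> oD cL; elim: k f => [|k IH] f.
  by move=> cf q Dq; apply: continuous_comp; [exact: cf|exact: cL].
move=> /CkSP[df Df]; apply/CkSP; split=> [q Dq|v].
  apply: (@differentiable_comp _ _ _ _ f L); first exact: df.
  exact: linear_differentiable.
apply: Ck_ext (IH _ (Df v)) => // q Dq.
by rewrite derive_linear_comp//; exact: df.
Qed.

Lemma Ck_id k D : Ck_on k (fun q : V => q) D.
Proof.
case: k => [|k]; first by move=> q _; exact: cvg_id.
apply/CkSP; split=> [q _|v]; first exact: ex_diff.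
have -> : (fun q => 'D_v (fun q => q) q) = (fun=> v) by apply/funext => q; rewrite derive_id.
exact: Ck_cst.
Qed.

(** [Ck_on] speaks of derivatives in fixed directions, whereas the chain rule differentiates [g] in
    the direction ['D_v f q], which moves with [q]. Expanding that direction in a basis leaves fixed
    directions [e i] with C^k coefficients, and the induction applies to each ['D_(e i) g]. The
    basis is a parameter so that both row vectors and the scalar line are covered. *)
Lemma Ck_comp_basis (W : normedModType R) n (e : 'I_n -> W) (c : 'I_n -> {linear W -> R})
    k (f : V -> W) (g : W -> R) D E :
  (forall w, w = \sum_i c i w *: e i) -> (forall i, continuous (c i)) ->
  open D -> open E -> (forall q, D q -> E (f q)) ->
  Ck_on k f D -> Ck_on k g E -> Ck_on k (fun q => g (f q)) D.
Proof.
move=> ec cc oD oE DE; elim: k f g DE => [|k IH] f g DE.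
  move=> cf cg q Dq; apply: continuous_comp; first exact: cf.
  by apply: cg; rewrite inE; apply/DE/set_mem.
move=> Cf Cg; have /CkSP[df Df] := Cf; have /CkSP[dg Dg] := Cg; apply/CkSP; split=> [q Dq|v].
  by apply: differentiable_comp; [exact: df|exact/dg/DE].
have C : Ck_on k (fun q => \sum_i c i ('D_v f q) * 'D_(e i) g (f q)) D.
  apply: (Ck_sum _ _ oD) => i; apply: CkM => //; first exact: Ck_linear_comp.
  by apply: (IH f ('D_(e i) g)) => //; exact: CkS.
apply: Ck_ext C => // q Dq.
rewrite [RHS]deriveE; last by apply: differentiable_comp; [exact: df|exact/dg/DE].
rewrite (@diff_comp _ _ _ _ f g)//=; [|exact: df|exact/dg/DE].
rewrite -(deriveE _ (df q Dq)).
rewrite [in RHS](ec ('D_v f q)) linear_sum.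
by apply: eq_bigr => i _; rewrite linearZ/= (deriveE _ (dg _ (DE _ Dq))).
Qed.

Lemma differentiable_mx m n (f : V -> 'M[R]_(m, n)) q :
  (forall i j, differentiable (fun r => f r i j) q) -> differentiable f q.
Proof.
move=> df.
have -> : f = \sum_(i < m) \sum_(j < n) (fun r => f r i j *: delta_mx i j).
  apply/funext => r; rewrite fct_sumE [LHS]matrix_sum_delta.
  by apply: eq_bigr => i _; rewrite fct_sumE.
by do 2 (apply: differentiable_sum => ?); exact: differentiableZl.
Qed.

Lemma derive_coord m n (f : V -> 'M[R]_(m, n)) q v i j : differentiable f q ->
  'D_v f q i j = 'D_v (fun r => f r i j) q.
Proof. by move=> df; rewrite derive_mx ?mxE//; exact: diff_derivable. Qed.

Lemma coord_linear m n i j : linear (fun A : 'M[R]_(m, n) => A i j : R^o).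
Proof. by move=> a A B; rewrite !mxE. Qed.

Lemma Ck_mx m n k (f : V -> 'M[R]_(m, n)) D : open D ->
  (forall i j, Ck_on k (fun q => f q i j) D) -> Ck_on k f D.
Proof.
move=> oD; elim: k f => [|k IH] f Cf.
  move=> q Dq /=; apply/cvgrPdist_le => e e0; near=> r.
  rewrite /Num.Def.normr/= mx_normrE (bigmax_le _ (ltW e0))//= => i _; rewrite !mxE.
  move: i; near: r; apply: filter_forall => -[i j]/=.
  by have /cvgrPdist_le/(_ e e0) := Cf i j q Dq.
apply/CkSP; split=> [q Dq|v]; first by apply: differentiable_mx => i j; exact: (Cf i j).1.
apply: IH => i j; apply: Ck_ext ((Cf i j).2 v) => // q Dq.
rewrite derive_mx ?mxE//; apply/diff_derivable/differentiable_mx => a b.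
exact: (Cf a b).1.
Unshelve. all: by end_near. Qed.

Lemma Ck_coord m n k (f : V -> 'M[R]_(m, n)) D i j : open D ->
  Ck_on k f D -> Ck_on k (fun q => f q i j) D.
Proof.
move=> oD Cf.
pose L : {linear 'M[R]_(m, n) -> R^o} := 
  HB.pack (fun A : 'M[R]_(m, n) => A i j : R^o) (GRing.isLinear.Build _ _ _ _ _ (@coord_linear m n i j)).
exact: (@Ck_linear_comp 'M[R]_(m, n) R^o k L f D oD (@coord_continuous R m n i j) Cf).
Qed.

End Ck.

Lemma coord_basis (R : realType) n : exists c : 'I_n -> {linear 'rV[R]_n -> R},
  [/\ forall i, continuous (c i), forall i w, c i w = w 0 i
    & forall w, w = \sum_i c i w *: delta_mx 0 i].
Proof.
pose c i : {linear 'rV[R]_n -> R^o} := HB.pack (fun A : 'rV[R]_n => A 0 i : R^o)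
  (GRing.isLinear.Build _ _ _ _ _ (@coord_linear R 1 n 0 i)).
exists c; split=> //.
- by move=> i; exact: coord_continuous.
- by move=> w; rewrite {1}(row_sum_delta w).
Qed.

Lemma Ck_comp (R : realType) (V : normedModType R) n k (f : V -> 'rV[R]_n)
    (g : 'rV[R]_n -> R) D E :
  open D -> open E -> (forall q, D q -> E (f q)) ->
  Ck_on k f D -> Ck_on k g E -> Ck_on k (fun q => g (f q)) D.
Proof.
have [c [cc _ ec]] := coord_basis R n.
exact: (Ck_comp_basis ec cc).
Qed.

Lemma Ck_comp_mx (R : realType) (V : normedModType R) n m p k (f : V -> 'rV[R]_n)
    (g : 'rV[R]_n -> 'M[R]_(m, p)) D E :
  open D -> open E -> (forall q, D q -> E (f q)) ->
  Ck_on k f D -> Ck_on k g E -> Ck_on k (fun q => g (f q)) D.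
Proof.
move=> oD oE DE Cf Cg; apply: Ck_mx => // i j.
exact: (Ck_comp oD oE DE Cf (Ck_coord i j oE Cg)).
Qed.

Lemma Ck_comp1 (R : realType) (V : normedModType R) k (f : V -> R) (g : R -> R) D E :
  open D -> open E -> (forall q, D q -> E (f q)) ->
  Ck_on k f D -> Ck_on k g E -> Ck_on k (fun q => g (f q)) D.
Proof.
apply: (@Ck_comp_basis R V R 1 (fun=> 1) (fun=> idfun)).
- by move=> w; rewrite big_ord1 /= [_ *: _]mulr1.
- by move=> _ x; exact: cvg_id.
Qed.

Lemma derive_1 (R : realType) (f : R -> R) (v q : R) : differentiable f q ->
  'D_v f q = v * 'D_1 f q.
Proof.
by move=> df; rewrite !deriveE// -[in LHS](mulr1 v) -[v * 1]/(v *: 1) linearZ.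
Qed.

Lemma Ck_is_derive (R : realType) k (f df : R -> R) (D : set R) : open D ->
  (forall q, D q -> is_derive q 1 f (df q)) -> Ck_on k df D -> Ck_on k.+1 f D.
Proof.
move=> oD Df Cdf.
have dfq q : D q -> differentiable f q by move=> /Df[fq _]; exact/derivable1_diffP.
apply/CkSP; split=> // v; apply: Ck_ext (CkM oD (Ck_cst k v D) Cdf) => // q Dq.
by rewrite derive_1; [have [_ ->] := Df _ Dq|exact: dfq].
Qed.

Lemma Ck_inv (R : realType) k : Ck_on k (fun x : R => x^-1) [set x | x != 0].
Proof.
have oD : open [set x : R | x != 0] by exact: open_neq.
elim: k => [|k IH].
  by move=> q; rewrite inE /= => q0; exact: inv_continuous.
have C := CkN oD (CkM oD IH IH).
apply: (Ck_is_derive oD _ C) => q q0.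
apply: DeriveDef; first exact: derivableV.
rewrite deriveV// derive_id [LHS]mulr1; congr (- _).
by rewrite expr2 invfM.
Qed.

Lemma Ck_cos_sin (R : realType) k (D : set R) : open D -> Ck_on k cos D /\ Ck_on k sin D.
Proof.
move=> oD; elim: k => [|k [IHc IHs]].
  by split=> q _; [exact: continuous_cos|exact: continuous_sin].
split.
  by apply: (Ck_is_derive oD _ (CkN oD IHs)) => q _; exact: is_derive_cos.
by apply: (Ck_is_derive oD _ IHc) => q _; exact: is_derive_sin.
Qed.

Lemma CkV (R : realType) (V : normedModType R) k (f : V -> R) D : open D ->
  (forall q, D q -> f q != 0) -> Ck_on k f D -> Ck_on k (fun q => (f q)^-1) D.
Proof.
move=> oD f0 Cf.
exact: (Ck_comp1 (g := fun x : R => x^-1) oD (@open_neq R 0) f0 Cf (Ck_inv R k)).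
Qed.

Lemma Ck_atan (R : realType) k (D : set R) : open D -> Ck_on k atan D.
Proof.
move=> oD; case: k => [|k]; first by move=> q _; exact: continuous_atan.
have C : Ck_on k (fun x : R => (1 + x * x)^-1) D.
  apply: CkV => // [q _|]; first by rewrite gt_eqF// ltr_pwDl// -expr2 sqr_ge0.
  by apply: CkD => //; [exact: Ck_cst|apply: CkM => //; exact: Ck_id].
by apply: (Ck_is_derive oD _ C).
Qed.

(** * Symmetry of second derivatives *)

Lemma is_derive_line (R : realType) (V : normedModType R) (f : V -> R) (a v : V) (s : R) :
  differentiable f (a + s *: v) ->
  is_derive s 1 (fun t : R => f (a + t *: v)) ('D_v f (a + s *: v)).
Proof.
move=> df.
have dl : is_diff s (fun t : R => a + t *: v) (fun t => t *: v).
  have : is_diff s (cst a + ( *:%R^~ v)) (0 + ( *:%R^~ v)) by apply: is_diffD.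
  by rewrite add0r.
have dfl : differentiable (f \o (fun t : R => a + t *: v)) s.
  by apply: differentiable_comp.
apply: DeriveDef; first exact: diff_derivable.
rewrite deriveE// (@diff_comp _ _ _ _ (fun t : R => a + t *: v) f)//=.
by rewrite diff_val scale1r deriveE.
Qed.

Lemma MVT_line (R : realType) (V : normedModType R) (f : V -> R) (a v : V) (h : R) :
  0 < h -> (forall s, 0 <= s <= h -> differentiable f (a + s *: v)) ->
  exists2 s, 0 <= s <= h & f (a + h *: v) - f a = h * 'D_v f (a + s *: v).
Proof.
move=> h0 df.
have D s : 0 <= s <= h -> is_derive s 1 (fun t : R => f (a + t *: v)) ('D_v f (a + s *: v)).
  by move=> /df; exact: is_derive_line.
have [s sh E] : exists2 s, s \in `[0, h]%R & f (a + h *: v) - f (a + 0 *: v) =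
    'D_v f (a + s *: v) * (h - 0).
  apply: (@MVT_segment _ (fun t : R => f (a + t *: v)) (fun s => 'D_v f (a + s *: v)) 0 h (ltW h0)).
    by move=> x; rewrite in_itv/= => /andP[/ltW x0 /ltW xh]; apply: D; rewrite x0.
  apply: derivable_within_continuous => x; rewrite in_itv/= => /D Dx.
  exact: ex_derive.
exists s; first by move: sh; rewrite in_itv.
by rewrite mulrC -[h in RHS](subr0 h) -E scale0r addr0.
Qed.

(** Two applications of the mean value theorem: along [v] to the difference of [f] on two parallel
    segments, then along [w] to ['D_v f]. The left side is symmetric in [v] and [w], which is its
    purpose. *)
Lemma mixed_difference (R : realType) (V : normedModType R) (f : V -> R) (q v w : V) (h : R) :
  0 < h ->
  (forall s t, 0 <= s <= h -> 0 <= t <= h -> differentiable f (q + s *: v + t *: w) /\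
     differentiable ('D_v f) (q + s *: v + t *: w)) ->
  exists s t, [/\ 0 <= s <= h, 0 <= t <= h &
    f (q + h *: v + h *: w) - f (q + h *: v) - (f (q + h *: w) - f q) =
    h * (h * 'D_w ('D_v f) (q + s *: v + t *: w))].
Proof.
move=> h0 df.
have hh : 0 <= h <= h by rewrite ltW/=.
have h00 : 0 <= (0 : R) <= h by rewrite lexx ltW.
pose phi s := f (q + h *: w + s *: v) - f (q + s *: v).
have D s : 0 <= s <= h -> is_derive s 1 phi
    ('D_v f (q + h *: w + s *: v) - 'D_v f (q + s *: v)).
  move=> sh; apply: is_deriveB; apply: is_derive_line.
    by rewrite addrAC; exact: (df _ _ sh hh).1.
  by rewrite -[X in differentiable _ X]addr0 -(scale0r w); exact: (df _ _ sh h00).1.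
have [s] : exists2 s, s \in `[0, h]%R & phi h - phi 0 =
    ('D_v f (q + h *: w + s *: v) - 'D_v f (q + s *: v)) * (h - 0).
  apply: (@MVT_segment _ phi _ 0 h (ltW h0)).
    by move=> x; rewrite in_itv/= => /andP[/ltW x0 /ltW xh]; apply: D; rewrite x0.
  apply: derivable_within_continuous => x; rewrite in_itv/= => /D Dx.
  exact: ex_derive.
rewrite in_itv /= subr0 /phi scale0r !addr0 => sh E.
have [|t th E2] := @MVT_line _ _ ('D_v f) (q + s *: v) w h h0.
  by move=> t th; exact: (df _ _ sh th).2.
exists s, t; split=> //; rewrite -E2 [RHS]mulrC.
by rewrite [q + h *: v + _]addrAC [q + s *: v + _]addrAC -E.
Qed.

(** The second difference over a small parallelogram equals h^2 times either mixed derivative, each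
    taken at some point of the parallelogram; continuity of both at [q] makes their values there
    differ by less than any [e]. *)
Lemma derive_symmetric (R : realType) (V : normedModType R) (f : V -> R) (D : set V) (q v w : V) :
  open D -> Ck_on 2 f D -> D q -> 'D_v ('D_w f) q = 'D_w ('D_v f) q.
Proof.
move=> oD Cf Dq; have /CkSP[df Df] := Cf.
have ddf u r : D r -> differentiable ('D_u f) r by have /CkSP[+ _] := Df u; apply.
have cvw u u' : {for q, continuous ('D_u ('D_u' f))}.
  by have /CkSP[_ /(_ u) c] := Df u'; apply: c; rewrite inE.
apply/eqP; rewrite -subr_eq0 -normr_le0; apply/ler_addgt0Pr => _/posnumP[e].
rewrite add0r.
have : \forall r \near q, [/\ D r, `|'D_v ('D_w f) q - 'D_v ('D_w f) r| < e%:num / 2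
    & `|'D_w ('D_v f) q - 'D_w ('D_v f) r| < e%:num / 2].
  have e2 : 0 < e%:num / 2 by [].
  have N u u' : \forall r \near q, `|'D_u ('D_u' f) q - 'D_u ('D_u' f) r| < e%:num / 2.
    by move/cvgrPdist_lt : (cvw u u'); exact.
  have ND : \forall r \near q, D r by exact: open_nbhs_nbhs.
  have [Nvw Nwv] := (N v w, N w v).
  by apply: filterS (filterI ND (filterI Nvw Nwv)) => r [Dr [A B]]; split.
move=> /nbhs_ballP[d /= d0 B].
(* Small enough for the whole parallelogram to lie in the ball of radius [d]; the 1 keeps the
   denominator positive when [v] and [w] vanish. *)
pose h := d / (2 * (`|v| + `|w| + 1)).
have k0 : 0 < `|v| + `|w| + 1 by rewrite ltr_wpDl ?addr_ge0.
have h0 : 0 < h by rewrite divr_gt0 ?mulr_gt0.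
have Bst s t : 0 <= s <= h -> 0 <= t <= h -> ball q d (q + s *: v + t *: w).
  move=> /andP[s0 sh] /andP[t0 th]; rewrite -ball_normE /ball_/=.
  rewrite -addrA opprD addNKr normrN.
  rewrite (le_lt_trans (ler_normD _ _))// !normrZ ger0_norm// ger0_norm//.
  have : s * `|v| + t * `|w| <= h * (`|v| + `|w|).
    by rewrite mulrDr lerD// ler_wpM2r.
  move/le_lt_trans; apply.
  rewrite /h -mulrA gtr_pMr// mulrC ltr_pdivrMr ?mulr_gt0// mul1r.
  have := normr_ge0 v; have := normr_ge0 w; lra.
have [|s1 [t1 [s1h t1h E1]]] := @mixed_difference _ _ f q v w h h0.
  by move=> s t sh th; have [Dr _ _] := B _ (Bst s t sh th); split; [exact: df|exact: ddf].
have [|s2 [t2 [s2h t2h E2]]] := @mixed_difference _ _ f q w v h h0.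
  move=> s t sh th; rewrite addrAC; have [Dr _ _] := B _ (Bst t s th sh).
  by split; [exact: df|exact: ddf].
have E : 'D_w ('D_v f) (q + s1 *: v + t1 *: w) = 'D_v ('D_w f) (q + s2 *: w + t2 *: v).
  have hn : h != 0 by rewrite gt_eqF.
  apply: (mulfI hn); apply: (mulfI hn).
  apply: (etrans (esym E1)); apply: etrans E2.
  by rewrite (addrAC q (h *: w)); ring.
have [_ _ A1] := B _ (Bst _ _ s1h t1h).
have [_ A2 _] := B _ (Bst _ _ t2h s2h).
rewrite E distrC in A1; rewrite (addrAC q (t2 *: v)) in A2.
have A3 := ltrD A2 A1; rewrite -splitr in A3.
exact: (le_trans (ler_distD _ _ _) (ltW A3)).
Qed.

(** * The inverse function theorem *)

Section RowNorm.
Context {R : realType}.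

Lemma norm_coord_le n (v : 'rV[R]_n) i : `|v 0 i| <= `|v|.
Proof. by rewrite [leRHS]/Num.Def.normr/= mx_normrE; exact: (le_bigmax _ _ (0, i)). Qed.

Lemma norm_row_le n (v : 'rV[R]_n) c : 0 <= c -> (forall i, `|v 0 i| <= c) -> `|v| <= c.
Proof.
move=> c0 vc; rewrite [leLHS]/Num.Def.normr/= mx_normrE (bigmax_le _ c0)// => -[i j] _.
by rewrite (ord1 i).
Qed.

Lemma norm_mulmx_le n (v : 'rV[R]_n) (A : 'M[R]_n) c : 0 <= c ->
  (forall i j, `|A i j| <= c) -> `|v *m A| <= c *+ n * `|v|.
Proof.
move=> c0 Ac; apply: norm_row_le => [|j]; first by rewrite mulr_ge0// mulrn_wge0.
rewrite mxE (le_trans (ler_norm_sum _ _ _))// mulrnAl -[X in _ <= _ *+ X]card_ord -sumr_const.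
by apply: ler_sum => i _; rewrite normrM mulrC ler_pM// norm_coord_le.
Qed.

Lemma norm_mulmx_bound n (A : 'M[R]_n) : exists2 c, 0 < c & forall v : 'rV[R]_n, `|v *m A| <= c * `|v|.
Proof.
exists (`|A| *+ n + 1); first by rewrite ltr_wpDl// mulrn_wge0.
move=> v; rewrite (le_trans (norm_mulmx_le v (normr_ge0 A) _))//.
  by move=> i j; rewrite [leRHS]/Num.Def.normr/= mx_normrE; exact: (le_bigmax _ _ (i, j)).
by rewrite ler_wpM2r// lerDl.
Qed.

End RowNorm.

Lemma ball_segment (R : realType) (V : normedModType R) (q a b : V) (r s : R) :
  0 <= s <= 1 -> ball q r a -> ball q r b -> ball q r (a + s *: (b - a)).
Proof.
rewrite -ball_normE /ball_/= => /andP[s0 s1] ar br.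
have -> : q - (a + s *: (b - a)) = (1 - s) *: (q - a) + s *: (q - b).
  rewrite scalerBl scale1r -addrA -scalerN -scalerDr opprB opprD addrA; congr (_ + _).
  by rewrite -scalerN opprB subrKA.
rewrite (le_lt_trans (ler_normD _ _))// !normrZ !ger0_norm ?subr_ge0//.
(* Strictness is drawn from the term weighted by [s], which yields none when [s = 0]. *)
have [->|s0'] := eqVneq s 0; first by rewrite subr0 mul1r mul0r addr0.
have : s * `|q - b| < s * r by rewrite ltr_pM2l// lt_def s0'.
have : (1 - s) * `|q - a| <= (1 - s) * r by rewrite ler_wpM2l ?subr_ge0// ltW.
lra.
Qed.

Lemma linear_approx_diff (R : realType) (V W : normedModType R) (f : V -> W)
    (L : {linear V -> W}) (x : V) : continuous L ->
  (forall e : R, 0 < e -> \forall h \near (0 : V), `|f (h + x) - (f x + L h)| <= e * `|h|) ->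
  differentiable f x /\ 'd f x = L :> (V -> W).
Proof.
move=> Lc fL.
have df : f \o shift x = cst (f x) + L +o_ 0 id.
  by apply/eqaddoP => _/posnumP[e]; exact: fL.
have E := diff_unique Lc df.
by split=> //; apply/diff_locallyP; rewrite E.
Qed.

(** Put d = G(y + h) - G(y). Since [L] inverts the differential on the left, d - L h = - L (h -
    dF(d)), and h - dF(d) is o(d) by differentiability of [F], hence o(h) by the Lipschitz bound on
    [G] at [y]. *)
Lemma differentiable_inverse (R : realType) (V W : normedModType R)
    (F : V -> W) (G : W -> V) (L : {linear W -> V}) (y : W) (c : R) :
  differentiable F (G y) -> continuous L -> (forall v, L ('d F (G y) v) = v) ->
  (\forall z \near y, F (G z) = z) ->
  (\forall z \near y, `|G z - G y| <= c * `|z - y|) ->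
  differentiable G y /\ 'd G y = L :> (W -> V).
Proof.
move=> dF Lc LJ FG Gc; set x := G y.
have [b b0 Jb] := linear_lipschitz Lc.
(* A positive Lipschitz constant, so that it may be divided by. *)
pose c' := `|c| + 1.
have c'0 : 0 < c' by rewrite ltr_wpDl.
have {}Gc : \forall z \near y, `|G z - G y| <= c' * `|z - y|.
  apply: filterS Gc => z /le_trans; apply; rewrite ler_wpM2r// /c'.
  by rewrite (le_trans (ler_norm _))// lerDl.
apply: linear_approx_diff => // _/posnumP[e].
have d0 : 0 < e%:num / (b * c') by rewrite divr_gt0// mulr_gt0.
have /diff_locallyP[_ /eqaddoP /(_ _ d0) Fo] := dF.
have sh := @cvg_shift0 R _ y.
have Gh : \forall h \near (0 : W), `|G (h + y) - G y| <= c' * `|h|.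
  have G0 : \forall h \near (0 : W), `|G (h + y) - G y| <= c' * `|h + y - y|.
    exact: (sh _ Gc).
  by apply: filterS G0 => h /=; rewrite addrK.
have FGh : \forall h \near (0 : W), F (G (h + y)) = h + y by exact: (sh _ FG).
have cG : (fun h : W => G (h + y) - G y) @ (0 : W) --> (0 : V).
  apply/cvgrPdist_lt => k k0.
  have hk : \forall h \near (0 : W), `|h| < k / c'.
    by apply: nbhs0_lt; rewrite divr_gt0.
  near=> h; rewrite sub0r normrN.
  have hy : `|G (h + y) - G y| <= c' * `|h| by near: h.
  rewrite (le_lt_trans hy)// mulrC -ltr_pdivlMr//.
  by near: h.
have Foh : \forall h \near (0 : W),
    `|F (G (h + y) - G y + G y) - (F (G y) + 'd F (G y) (G (h + y) - G y))| <=
    e%:num / (b * c') * `|G (h + y) - G y| by exact: (cG _ Fo).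
near=> h; rewrite opprD addrA.
set d := G (h + y) - G y.
have dh : `|d| <= c' * `|h| by rewrite /d; near: h.
have Fd : `|h - 'd F x d| <= e%:num / (b * c') * `|d|.
  have -> : h - 'd F x d = F (d + x) - (F x + 'd F x d).
    rewrite /d opprD addrA subrK; have -> : F (G (h + y)) = h + y by near: h.
    by rewrite /x (nbhs_singleton FG) addrK.
  by rewrite /d; near: h.
have -> : d - L h = - L (h - 'd F x d) by rewrite linearB/= LJ opprB.
rewrite normrN (le_trans (Jb _))// (le_trans (ler_wpM2l (ltW b0) Fd))//.
rewrite (le_trans (ler_wpM2l (ltW b0) (ler_wpM2l (ltW d0) dh)))//.
rewrite le_eqVlt; apply/orP; left; apply/eqP; field.
by rewrite !gt_eqF.
Unshelve. all: by end_near. Qed.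

Lemma Ck_det (R : realType) (V : normedModType R) n k (M : V -> 'M[R]_n) D : open D ->
  (forall i j, Ck_on k (fun q => M q i j) D) -> Ck_on k (fun q => \det (M q)) D.
Proof.
move=> oD CM; rewrite /determinant; apply: (Ck_sum _ _ oD) => s.
apply: (CkM oD); first exact: Ck_cst.
by apply: (Ck_prod _ _ oD) => i; exact: CM.
Qed.

(** Cramer's rule: each entry is a cofactor, with transposed indices, over the determinant. *)
Lemma Ck_invmx (R : realType) (V : normedModType R) n k (M : V -> 'M[R]_n) D : open D ->
  (forall q, D q -> M q \in unitmx) ->
  (forall i j, Ck_on k (fun q => M q i j) D) ->
  forall i j, Ck_on k (fun q => invmx (M q) i j) D.
Proof.
move=> oD uM CM i j.
have C : Ck_on k (fun q => (\det (M q))^-1 * ((-1) ^+ (j + i) * \det (row' j (col' i (M q))))) D.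
  apply: (CkM oD).
    apply: CkV => //; last exact: Ck_det.
    by move=> q /uM; rewrite unitmxE unitfE.
  apply: (CkM oD); first exact: Ck_cst.
  apply: Ck_det => // a b.
  have -> : (fun q => row' j (col' i (M q)) a b) = (fun q => M q (lift j a) (lift i b)).
    by apply/funext => q; rewrite !mxE.
  exact: CM.
by apply: Ck_ext C => // q /uM Mq; rewrite /invmx Mq !mxE.
Qed.

Lemma continuous_mulmxr (R : realType) n (A : 'M[R]_n) :
  continuous (mulmxr A : 'rV[R]_n -> 'rV[R]_n).
Proof.
have [b b0 Ab] := norm_mulmx_bound A.
apply/linear_bounded_continuous/linear_boundedP; exists b; split; first exact: gtr0_real.
by move=> r br v /=; rewrite (le_trans (Ab v))// ler_wpM2r// ltW.
Qed.

Lemma Ck_mulmxr (R : realType) (V : normedModType R) n k (f : V -> 'rV[R]_n) (A : 'M[R]_n) D :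
  open D -> Ck_on k f D -> Ck_on k (fun q => f q *m A) D.
Proof.
move=> oD Cf.
exact: (@Ck_linear_comp _ _ _ _ k (mulmxr A) f D oD (@continuous_mulmxr R n A) Cf).
Qed.

(** All partial derivatives vanish at [q0], so they are uniformly small nearby; the mean value
    theorem on segments, applied to each coordinate, converts this into a Lipschitz bound. *)
Lemma flat_contraction (R : realType) n (h : 'rV[R]_n -> 'rV[R]_n) (D : set 'rV[R]_n)
    (q0 : 'rV[R]_n) :
  open D -> D q0 -> Ck_on 1 h D -> (forall v, 'D_v h q0 = 0) ->
  exists2 r : R, 0 < r & ball q0 r `<=` D /\
    forall x y, ball q0 r x -> ball q0 r y -> `|h y - h x| <= 2^-1 * `|y - x|.
Proof.
move=> oD Dq0 Ch h0.
pose hj j x := h x 0 j.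
have Chj j : Ck_on 1 (hj j) D by exact: Ck_coord.
have dh x : D x -> differentiable h x by have /CkSP[+ _] := Ch; exact.
have dhj j x : D x -> differentiable (hj j) x by have /CkSP[+ _] := Chj j; exact.
have hj0 v j : 'D_v (hj j) q0 = 0.
  by have := h0 v; rewrite derive_mx; [move/rowP/(_ j); rewrite !mxE|exact/diff_derivable/dh].
(* The [n] partial derivatives of a coordinate add up to at most n / (2 (n + 1)), below 1/2; the
   successor keeps the denominator nonzero for [n = 0]. *)
pose c : R := (2 * n.+1%:R)^-1.
have c0 : 0 < c by rewrite invr_gt0 mulr_gt0.
have N1 : \forall x \near q0, D x by exact: open_nbhs_nbhs.
have N2 : \forall x \near q0, forall i j, `|'D_(delta_mx 0 i) (hj j) x| <= c.
  pose P (ij : 'I_n * 'I_n) x := `|'D_(delta_mx 0 ij.1) (hj ij.2) x| <= c.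
  suff : \forall x \near q0, forall ij, P ij x.
    by apply: filterS => x Px i j; exact: (Px (i, j)).
  have FF : Filter (nbhs q0) by exact: nbhs_filter.
  have PF := @filter_forall _ _ P _ FF; apply: PF => -[i j].
  have /CkSP[_ /(_ (delta_mx 0 i)) cj] := Chj j.
  have /cvgrPdist_le/(_ c c0) : {for q0, continuous ('D_(delta_mx 0 i) (hj j))}.
    by apply: cj; rewrite inE.
  by apply: filterS => x /=; rewrite hj0 sub0r normrN.
have [r /= r0 B] := (nbhs_ballP _ _).1 (filterI N1 N2).
exists r => //; split=> [x /B[]//|x y xr yr].
apply: norm_row_le => [|j]; first by rewrite mulr_ge0.
rewrite !mxE.
have S s : 0 <= s <= 1 -> ball q0 r (x + s *: (y - x)) by move=> s01; exact: ball_segment.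
have [|s s01] := @MVT_line _ _ (hj j) x (y - x) 1 ltr01.
  by move=> s /S/B[Ds _]; exact: dhj.
have [Ds cs] := B _ (S _ s01).
rewrite scale1r [x + _]addrC subrK mul1r -/(hj j y) -/(hj j x) => ->.
rewrite deriveE; last exact: dhj.
rewrite [in X in 'd _ _ X](row_sum_delta (y - x)) linear_sum.
rewrite (le_trans (ler_norm_sum _ _ _))//.
apply: (@le_trans _ _ (\sum_(i < n) `|y - x| * c)).
  apply: ler_sum => i _; rewrite linearZ/= normrM ler_pM//; first exact: norm_coord_le.
  by rewrite -deriveE//; exact: dhj.
rewrite sumr_const card_ord -mulrnAr mulrC ler_wpM2r// /c -mulr_natl.
rewrite invfM mulrCA ler_piMr// ler_pdivrMr// mul1r ler_nat.
by [].
Qed.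

Lemma jacobian_entry (R : realType) n m (F : 'rV[R]_n -> 'rV[R]_m) (q : 'rV[R]_n) i j :
  differentiable F q -> jacobian F q i j = 'D_(delta_mx 0 i) (fun x => F x 0 j) q.
Proof.
move=> dF; have := deriveEjacobian (delta_mx 0 i) dF; rewrite -rowE => /rowP/(_ j).
by rewrite mxE => <-; rewrite derive_mx ?mxE//; exact: diff_derivable.
Qed.

Lemma Ck_jacobian (R : realType) n m k (F : 'rV[R]_n -> 'rV[R]_m) (D : set 'rV[R]_n) i j :
  open D -> Ck_on k.+1 F D -> Ck_on k (fun q => jacobian F q i j) D.
Proof.
move=> oD CF; have /CkSP[dF _] := CF.
have /CkSP[_ /(_ (delta_mx 0 i)) C] := Ck_coord 0 j oD CF.
by apply: Ck_ext C => // q /dF Fq; rewrite jacobian_entry.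
Qed.

(* For [y] close to [F q0], a minimizer of [|(y - F x) *m L|] is a solution
   of [F x = y]: one step of the chord method [x + (y - F x) *m L] would
   otherwise decrease this quantity. *)
Lemma chord_method_solution (R : realType) n (F : 'rV[R]_n -> 'rV[R]_n) (L : 'M[R]_n)
    (q0 y : 'rV[R]_n) (r : R) :
  0 < r -> L \in unitmx ->
  (forall x, closed_ball q0 r x -> {for x, continuous F}) ->
  (forall a b, closed_ball q0 r a -> closed_ball q0 r b ->
     `|(b - F b *m L) - (a - F a *m L)| <= 2^-1 * `|b - a|) ->
  `|(y - F q0) *m L| < r / 2 ->
  exists2 x, ball q0 r x & F x = y.
Proof.
move=> r0 uL cF H yr.
pose K := closed_ball q0 r.
have KE x : K x = (`|q0 - x| <= r) by rewrite /K closed_ballE.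
have Kq0 : K q0 by rewrite KE subrr normr0 ltW.
pose phi x := `|(y - F x) *m L|.
have [p pK pmin] : exists2 p, p \in K & forall t, t \in K -> phi p <= phi t.
  apply: EVT_min_rV; first by exists q0.
    apply: bounded_closed_compact; last exact: closed_ball_closed.
    exists (`|q0| + r); split; first exact: num_real.
    move=> M MM x; rewrite KE => xr /=; rewrite (le_trans _ (ltW MM))//.
    rewrite -[x](subrK q0) addrC (le_trans (ler_normD _ _))// lerD2l.
    by rewrite distrC.
  apply: continuous_in_subspaceT => x /set_mem Kx.
  apply: continuous_comp; last exact: norm_continuous.
  apply: (@continuous_comp _ _ _ (fun x => y - F x) (mulmxr L)); last exact: continuous_mulmxr.
  by apply: continuousB; [exact: cst_continuous|exact: cF].
move: pK; rewrite inE => Kp.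
pose s := p + (y - F p) *m L.
have sE : s - q0 = (p - F p *m L) - (q0 - F q0 *m L) + (y - F q0) *m L.
  rewrite /s !mulmxBl; apply/rowP => i; rewrite !mxE; ring.
(* The step stays in the ball: the contraction contributes at most r / 2, and the residual at [q0]
   strictly less than r / 2. *)
have Hp := H _ _ Kq0 Kp.
have ps : `|q0 - s| < r.
  rewrite distrC sE (le_lt_trans (ler_normD _ _))//.
  rewrite [ltRHS](splitr r) ler_ltD// (le_trans Hp)//.
  by rewrite mulrC ler_pM2r// distrC -KE.
have Ks : K s by rewrite KE ltW.
have psE : phi s <= 2^-1 * phi p.
  have -> : phi s = `|(s - F s *m L) - (p - F p *m L)|.
    rewrite /phi /s !mulmxBl; congr (`| _ |); apply/rowP => i; rewrite !mxE; ring.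
  by rewrite (le_trans (H _ _ Kp Ks))// /s addrAC subrr add0r.
have p0 : phi p = 0.
  apply/eqP; rewrite eq_le normr_ge0 andbT.
  have := pmin s; rewrite inE => /(_ Ks) /le_trans /(_ psE).
  move: (phi p) => t; lra.
have yFp : y - F p = 0.
  have /eqP := p0; rewrite normr_eq0 => /eqP E.
  by rewrite -(mulmxK uL (y - F p)) E mul0mx.
(* The residual at [p] is zero, so [s] equals [p]; but it is [s] that is known to lie in the open
   ball. *)
exists s; first by rewrite -ball_normE.
by rewrite /s yFp mul0mx addr0; apply/esym/eqP; rewrite -subr_eq0 yFp.
Qed.

(** With [L] the inverse Jacobian at [q0], the map x - F(x) L is flat at [q0], hence a contraction
    nearby. This yields both a Lipschitz bound for the inverse, so injectivity, and the convergence
    condition of the chord method, so surjectivity onto a ball. *)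
Lemma inverse_function (R : realType) n (F : 'rV[R]_n -> 'rV[R]_n) (D : set 'rV[R]_n)
    (q0 : 'rV[R]_n) :
  open D -> D q0 -> smooth_on F D -> (forall v, 'D_v F q0 = 0 -> v = 0) ->
  exists (W : set 'rV[R]_n) (e : R) (G : 'rV[R]_n -> 'rV[R]_n),
    [/\ [/\ 0 < e, open W, W q0 & W `<=` D],
        forall q, W q -> ball (F q0) e (F q) /\ G (F q) = q,
        forall y, ball (F q0) e y -> W (G y) /\ F (G y) = y
      & smooth_on G (ball (F q0) e)].
Proof.
move=> oD Dq0 CF inj.
have dF x : D x -> differentiable F x by have /CkSP[+ _] := CF 1; exact.
pose J := jacobian F.
have uJ0 : J q0 \in unitmx.
  rewrite -row_free_unit; apply: inj_row_free => v vJ; apply: inj.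
  by rewrite deriveEjacobian//; exact: dF.
pose L := invmx (J q0).
have uL : L \in unitmx by rewrite unitmx_inv.
pose D1 := interior (D `&` [set x | \det (J x) != 0]).
have oD1 : open D1 by exact: open_interior.
have D1D x : D1 x -> D x /\ J x \in unitmx.
  by move=> /interior_subset[Dx]; rewrite /= unitmxE unitfE.
have D1q0 : D1 q0.
  have cdet : {for q0, continuous (fun x => \det (J x))}.
    have := Ck_det (k := 0) oD (fun i j => Ck_jacobian i j oD (CF 1)).
    by apply; rewrite inE.
  apply: filterI; first exact: open_nbhs_nbhs.
  have d0 : nbhs (\det (J q0)) [set d | d != 0].
    by apply: open_nbhs_nbhs; split; [exact: open_neq|rewrite /= -unitfE -unitmxE].
  exact: (cdet _ d0).
pose h x := x + F x *m (- L).
have Ch : Ck_on 1 h D1.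
  apply: (CkD oD1); first exact: Ck_id.
  by apply: Ck_mulmxr => //; apply: Ck_sub (CF 1) => x /D1D[].
have h0 v : 'D_v h q0 = 0.
  have dL : differentiable (fun x => F x *m (- L)) q0.
    by have /CkSP[+ _] := Ck_mulmxr (- L) oD (CF 1); apply.
  rewrite /h (@deriveD _ _ _ id)//; last exact: diff_derivable.
  rewrite derive_id (@derive_linear_comp _ _ _ _ (mulmxr (- L)) F q0)//=; last 2 first.
  - exact: continuous_mulmxr.
  - exact: dF.
  rewrite deriveEjacobian; last exact: dF.
  by rewrite mulmxN mulmxK// subrr.
have [r1 r10 [BD1 H]] := flat_contraction oD1 D1q0 Ch h0.
(* Halving puts the closed ball, needed for compactness, inside the open ball of contraction. *)
pose r := r1 / 2.
have r0 : 0 < r by rewrite divr_gt0.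
have BB x : closed_ball q0 r x -> ball q0 r1 x.
  by apply: closed_ball_subset => //; rewrite /r ltr_pdivrMr// mulr_natr mulr2n ltrDl.
have {}H a b : closed_ball q0 r a -> closed_ball q0 r b ->
     `|(b - F b *m L) - (a - F a *m L)| <= 2^-1 * `|b - a|.
  by move=> /BB ra /BB rb; have := H _ _ ra rb; rewrite /h !mulmxN.
have BC x : ball q0 r x -> closed_ball q0 r x by exact: subset_closed_ball.
have [c c0 Lc] := norm_mulmx_bound L.
(* For [y] within [e] of [F q0], the vector (y - F q0) L has norm below r / 2, as the chord method
   requires. *)
pose e := r / 2 / c.
have e0 : 0 < e by rewrite !divr_gt0.
pose B := ball (F q0) e.
have lip a b : closed_ball q0 r a -> closed_ball q0 r b ->
    `|b - a| <= 2 * c * `|F b - F a|.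
  move=> ra rb.
  have : `|b - a| <= 2^-1 * `|b - a| + c * `|F b - F a|.
    have E : b - a = (b - F b *m L) - (a - F a *m L) + (F b - F a) *m L.
      by rewrite mulmxBl; apply/rowP => i; rewrite !mxE; ring.
    by rewrite {1}E (le_trans (ler_normD _ _))// lerD//; exact: H.
  lra.
have sol y : B y -> exists2 x, ball q0 r x & F x = y.
  move=> By; have ye : `|F q0 - y| < e by move: By; rewrite /B -ball_normE.
  apply: (@chord_method_solution _ _ F L) => //.
    move=> x /BB/BD1/D1D[Dx _]; exact/differentiable_continuous/dF.
  by rewrite (le_lt_trans (Lc _))// mulrC -ltr_pdivlMr// distrC.
(* Off [B] the condition is void and any value serves. *)
have /choice[G GE] : forall y, exists x, B y -> ball q0 r x /\ F x = y.
  move=> y; have [By|nBy] := pselect (B y); last by exists 0.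
  by have [x] := sol _ By; exists x.
have oB : open B by exact: ball_open.
have dG y : B y -> differentiable G y /\ 'd G y = mulmxr (invmx (J (G y))) :> (_ -> _).
  move=> By; have [rx Fx] := GE _ By.
  have [DG uJ] := D1D _ (BD1 _ (BB _ (BC _ rx))).
  have nB : \forall z \near y, B z by exact: open_nbhs_nbhs.
  apply: (@differentiable_inverse _ _ _ F G _ y (2 * c)).
  - exact: dF.
  - exact: continuous_mulmxr.
  - by move=> v /=; rewrite -deriveE ?deriveEjacobian ?mulmxK//; exact: dF.
  - by apply: filterS nB => z /GE[].
  - apply: filterS nB => z /GE[rz Fz].
    by rewrite -{2}Fz -{2}Fx; apply: lip; exact: BC.
have DG y : B y -> D (G y) /\ J (G y) \in unitmx.
  by move=> /GE[rG _]; exact: (D1D _ (BD1 _ (BB _ (BC _ rG)))).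
have uJG y : B y -> J (G y) \in unitmx by move=> /DG[].
have CJ k : Ck_on k G B -> forall a b, Ck_on k (fun y => J (G y) a b) B.
  move=> Gk a b; have DGD y : B y -> D (G y) by move=> /DG[].
  exact: (@Ck_comp _ _ _ k G (fun x => J x a b) B D oB oD DGD Gk (Ck_jacobian a b oD (CF k.+1))).
have CG : smooth_on G B.
  (* Bootstrap: if [G] is C^k, so are the Jacobian of [F] along [G] and its inverse matrix; the
     latter is the derivative of [G], so [G] is C^(k+1). *)
  elim=> [|k IH].
    by move=> y /set_mem By; exact: (differentiable_continuous (dG _ By).1).
  apply/CkSP; split=> [y /dG[]//|w].
  apply: Ck_mx => // i j; rewrite (ord1 i).
  have C : Ck_on k (fun y => \sum_l w 0 l * invmx (J (G y)) l j) B.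
    apply: (Ck_sum _ _ oB) => l; apply: (CkM oB); first exact: Ck_cst.
    exact: (@Ck_invmx _ _ _ k (fun y => J (G y)) B oB uJG (CJ k IH) l j).
  apply: Ck_ext C => // y /dG[Gy E].
  by rewrite deriveE// E/= mxE.
(* Intersecting with the preimage of [B] makes [F] a bijection of this set onto the whole ball
   [B]. *)
exists (ball q0 r `&` F @^-1` B), e, G; split.
- split=> //.
  + rewrite openE => x [rx FBx].
    have nr : nbhs x (ball q0 r) by apply: open_nbhs_nbhs; split=> //; exact: ball_open.
    have nB : nbhs (F x) B by exact: open_nbhs_nbhs.
    have [Dx _] := D1D _ (BD1 _ (BB _ (BC _ rx))).
    by apply: filterI => //; exact: (differentiable_continuous (dF _ Dx) nB).
  + by split; exact: ballxx.
  + by move=> x [/BC/BB/BD1/D1D[]].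
- move=> q [rq Bq]; split=> //; have [rG FG] := GE _ Bq.
  apply/eqP; rewrite -subr_eq0 -normr_le0.
  by have := lip _ _ (BC _ rq) (BC _ rG); rewrite FG subrr normr0 mulr0.
- by move=> y By; have [rG FG] := GE _ By; split=> //; split=> //=; rewrite FG.
- exact: CG.
Qed.

(** * Lorentz-Minkowski space *)

Section Coordinates.
Context {R : realType}.

Lemma vec2E (a b : R) : vec2 a b 0 0 = a /\ vec2 a b 0 1 = b.
Proof. by rewrite !mxE. Qed.

Lemma ptE (p : 'rV[R]_2) (z : R) :
  [/\ pt p z 0 0 = p 0 0, pt p z 0 1 = p 0 1 & pt p z 0 ord_max = z].
Proof.
have e0 : (0 : 'I_3) = lshift 1 (0 : 'I_2) by exact: val_inj.
have e1 : (1 : 'I_3) = lshift 1 (1 : 'I_2) by exact: val_inj.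
have e2 : (ord_max : 'I_3) = rshift 2 (0 : 'I_1) by exact: val_inj.
split; first by rewrite e0; exact: row_mxEl.
  by rewrite e1; exact: row_mxEl.
by rewrite e2; apply: etrans (row_mxEr _ _ _ _) _; rewrite mxE.
Qed.

Lemma row2P (p q : 'rV[R]_2) : p 0 0 = q 0 0 -> p 0 1 = q 0 1 -> p = q.
Proof.
move=> e0 e1; apply/rowP => -[[|[|//]] lti].
  by rewrite (_ : Ordinal lti = 0)//; exact: val_inj.
by rewrite (_ : Ordinal lti = 1)//; exact: val_inj.
Qed.

Lemma row3P (p q : 'rV[R]_3) :
  p 0 0 = q 0 0 -> p 0 1 = q 0 1 -> p 0 ord_max = q 0 ord_max -> p = q.
Proof.
move=> e0 e1 e2; apply/rowP => -[[|[|[|//]]] lti].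
- by rewrite (_ : Ordinal lti = 0)//; exact: val_inj.
- by rewrite (_ : Ordinal lti = 1)//; exact: val_inj.
- by rewrite (_ : Ordinal lti = ord_max)//; exact: val_inj.
Qed.

(* The isometry is [- s], with [s] the reflection in the hyperplane
   orthogonal to [m = U + (0,0,1)], for which [<m, m> = - 2 (1 + z(U))]. *)
Lemma lorentz_isometry_to_vertical (U : 'rV[R]_3) :
  lorentz U U = -1 -> lorentz U (pt 0 1) < 0 ->
  exists2 A : 'M[R]_3, lorentz_linear_isometry A & U *m A = pt 0 1.
Proof.
move=> U1 U0.
have [E0 E1 E2] : [/\ pt 0 1 0 0 = 0 :> R, pt 0 1 0 1 = 0 :> R & pt 0 1 0 ord_max = 1 :> R].
  by have [-> -> ->] := ptE (0 : 'rV[R]_2) 1; rewrite !mxE.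
pose d := 1 + U 0 ord_max.
have d0 : d != 0.
  move: U0; rewrite /lorentz E0 E1 E2 !mulr0 add0r mulr1 sub0r oppr_lt0 => U0.
  by rewrite gt_eqF// ltr_wpDr// ltW.
pose m := U + pt 0 1.
have mE j : m 0 j = U 0 j + pt 0 1 0 j by rewrite [LHS]mxE.
have m0 : m 0 0 = U 0 0 by rewrite mE E0 addr0.
have m1 : m 0 1 = U 0 1 by rewrite mE E1 addr0.
have m2 : m 0 ord_max = d by rewrite mE E2 addrC.
pose f (w : 'rV[R]_3) : 'rV[R]_3 := - w - (lorentz w m / d) *: m.
have fl : linear f.
  move=> k a b; rewrite /f; move: m {mE m0 m1 m2 f} => m.
  by apply/rowP => j; rewrite /lorentz !mxE; ring.
pose L : {linear 'rV[R]_3 -> 'rV[R]_3} := HB.pack f (GRing.isLinear.Build _ _ _ _ _ fl).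
have LE a : a *m lin1_mx L = f a by rewrite mul_rV_lin1.
have mm : lorentz m m = - 2 * d.
  by move: U1; rewrite /lorentz m0 m1 m2 /d => U1; lra.
have fE (a b : 'rV[R]_3) s t : lorentz (- a - s *: m) (- b - t *: m) =
    lorentz a b + t * lorentz a m + s * lorentz b m + s * t * lorentz m m.
  by move: m {mE m0 m1 m2 mm f fl L LE} => m; rewrite /lorentz !mxE; ring.
exists (lin1_mx L).
  by move=> a b; rewrite !LE /f fE mm; field.
rewrite LE /f; have -> : lorentz U m = - d.
  by move: U1; rewrite /lorentz m0 m1 m2 /d => U1; lra.
by rewrite mulNr divff// scaleN1r opprK /m addKr.
Qed.

Lemma unit_angle (a b : R) : a * a + b * b = 1 -> exists t, a = cos t /\ b = sin t.
Proof.
move=> ab1.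
have a1 : -1 <= a <= 1.
  by rewrite -ler_norml -(expr_le1 (n := 2))// real_normK ?num_real// -ab1 -expr2 lerDl -expr2 sqr_ge0.
have sE : sin (acos a) = `|b|.
  by rewrite sin_acos// -ab1 expr2 addrAC subrr add0r -expr2 sqrtr_sqr.
have cE : cos (acos a) = a by exact: acosK.
have [b0|b0] := leP 0 b.
  by exists (acos a); rewrite cE sE ger0_norm.
by exists (- acos a); rewrite cosN sinN cE sE ltr0_norm// opprK.
Qed.

Lemma cos_sin_atan (p r : R) : 0 < p -> p * p + r * r = 1 ->
  cos (atan (r / p)) = p /\ sin (atan (r / p)) = r.
Proof.
move=> p0 pr.
have cE : cos (atan (r / p)) = p.
  rewrite cos_atan; have -> : 1 + (r / p) ^+ 2 = p^-1 ^+ 2.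
    have -> : 1 + (r / p) ^+ 2 = (p * p + r * r) * p^-1 ^+ 2 by field; rewrite gt_eqF.
    by rewrite pr mul1r.
  by rewrite sqrtr_sqr ger0_norm ?invrK// invr_ge0 ltW.
split=> //; have := atanK (r / p).
rewrite /tan cE => /(congr1 ( *%R^~ p)); rewrite divfK ?gt_eqF// => ->.
by rewrite divfK ?gt_eqF.
Qed.

End Coordinates.

(** Relative to the frame rotated to (a q0, b q0), the unit vector (a, b) has coordinates [p] and
    [r], the cosine and sine of the angle turned since [q0]. Near [q0] one has p > 0, so this angle
    is the smooth function atan(r / p). *)
Lemma local_angle (R : realType) (V : normedModType R) (a b : V -> R) (O : set V) (q0 : V) :
  open O -> O q0 -> smooth_on a O -> smooth_on b O ->
  (forall q, O q -> a q * a q + b q * b q = 1) ->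
  exists O' phi, [/\ open O', O' q0, O' `<=` O, smooth_on phi O' &
    forall q, O' q -> a q = cos (phi q) /\ b q = sin (phi q)].
Proof.
move=> oO Oq0 Ca Cb ab1.
have [t0 [at0 bt0]] := unit_angle (ab1 _ Oq0).
pose p q := a q * a q0 + b q * b q0.
pose r q := b q * a q0 - a q * b q0.
pose O' := interior (O `&` [set q | 0 < p q]).
have oO' : open O' by exact: open_interior.
have O'P q : O' q -> O q /\ 0 < p q by move=> /interior_subset.
have O'O : O' `<=` O by move=> q /O'P[].
have Cp k : Ck_on k p O.
  by apply: CkD => //; apply: CkM => //; exact: Ck_cst.
have Cr k : Ck_on k r O.
  by apply: CkB => //; apply: CkM => //; exact: Ck_cst.
exists O', (fun q => t0 + atan (r q / p q)); split=> //.
- have n1 : nbhs q0 O by exact: open_nbhs_nbhs.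
  have cp : {for q0, continuous p} by have := Cp 0; apply; rewrite inE.
  have n2 : nbhs (p q0) [set s | 0 < s].
    by apply: open_nbhs_nbhs; split; [exact: open_gt|rewrite /= /p ab1].
  exact: (filterI n1 (cp _ n2)).
- move=> k; apply: (CkD oO'); first exact: Ck_cst.
  have C : Ck_on k (fun q => r q / p q) O'.
    apply: (CkM oO'); first exact: Ck_sub (Cr k).
    apply: (CkV oO'); last exact: Ck_sub (Cp k).
    by move=> q /O'P[_ pq]; rewrite gt_eqF.
  exact: (@Ck_comp1 _ _ k _ atan O' setT oO' openT (fun _ _ => I) C (Ck_atan k openT)).
- move=> q /O'P[Oq pq].
  have [|cE sE] := cos_sin_atan (p := p q) (r := r q) pq.
    have := ab1 _ Oq; have := ab1 _ Oq0; rewrite /p /r.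
    move: (a q) (b q) (a q0) (b q0) => A B A0 B0 E0 E1.
    have -> : (A * A0 + B * B0) * (A * A0 + B * B0) + (B * A0 - A * B0) * (B * A0 - A * B0)
      = (A * A + B * B) * (A0 * A0 + B0 * B0) by ring.
    by rewrite E0 E1 mulr1.
  rewrite cosD sinD cE sE -at0 -bt0; have := ab1 _ Oq0; rewrite /p /r.
  move: (a q) (b q) (a q0) (b q0) => A B A0 B0 E0; split.
    have -> : A0 * (A * A0 + B * B0) - B0 * (B * A0 - A * B0) = A * (A0 * A0 + B0 * B0) by ring.
    by rewrite E0 mulr1.
  have -> : B0 * (A * A0 + B * B0) + A0 * (B * A0 - A * B0) = B * (A0 * A0 + B0 * B0) by ring.
  by rewrite E0 mulr1.
Qed.

(** * Coordinates adapted to a constant angle surface *)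

Section Straighten.
Context {R : realType}.

Lemma is_derive_cos_comp (V : normedModType R) (f : V -> R) (q v : V) : differentiable f q ->
  is_derive q v (fun r => cos (f r)) (- sin (f q) * 'D_v f q) /\
  is_derive q v (fun r => sin (f r)) (cos (f q) * 'D_v f q).
Proof.
move=> df.
have dc : differentiable (cos : R -> R) (f q) by apply/derivable1_diffP; exact: ex_derive.
have ds : differentiable (sin : R -> R) (f q) by apply/derivable1_diffP; exact: ex_derive.
split; apply: DeriveDef.
- by apply: diff_derivable; exact: (differentiable_comp df dc).
- rewrite deriveE; last exact: (differentiable_comp df dc).
  rewrite (@diff_comp _ _ _ _ f cos)//= -(deriveE _ df) -deriveE// derive_1//.
  by rewrite derive_val mulrC.
- by apply: diff_derivable; exact: (differentiable_comp df ds).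
- rewrite deriveE; last exact: (differentiable_comp df ds).
  rewrite (@diff_comp _ _ _ _ f sin)//= -(deriveE _ df) -deriveE// derive_1//.
  by rewrite derive_val mulrC.
Qed.

Lemma ball_coord (y0 y : 'rV[R]_2) (e : R) : 0 < e ->
  ball y0 e y <-> `|y0 0 0 - y 0 0| < e /\ `|y0 0 1 - y 0 1| < e.
Proof.
move=> epos; split.
  rewrite -ball_normE /= => h; split; apply: le_lt_trans h.
    by have := norm_coord_le (y0 - y) 0; rewrite !mxE.
  by have := norm_coord_le (y0 - y) 1; rewrite !mxE.
move=> [h0 h1]; split=> // i j; rewrite (ord1 i) -ball_normE /=.
have : j = 0 \/ j = 1 by case: j => -[|[|//]] ltj; [left|right]; exact: val_inj.
by move=> [->|->].
Qed.

(** Here [Y1] and [Y2] are the horizontal components of the surface in the coordinates (u, v). Their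
    u-derivatives depend on v alone, so they are affine in u and determined by one slice; on it the
    velocity is orthogonal to (cos v, sin v), which gives [S] and [C] the derivatives of the
    model. *)
Lemma straighten (Y1 Y2 : 'rV[R]_2 -> R) (y0 : 'rV[R]_2) (e ch sh : R) :
  let B := ball y0 e in
  0 < e -> sh != 0 -> smooth_on Y1 B -> smooth_on Y2 B ->
  (forall y, B y -> 'D_(delta_mx 0 0) Y1 y = ch * cos (y 0 1)) ->
  (forall y, B y -> 'D_(delta_mx 0 0) Y2 y = ch * sin (y 0 1)) ->
  (forall y, B y -> 'D_(delta_mx 0 1) Y1 y * cos (y 0 1) + 'D_(delta_mx 0 1) Y2 y * sin (y 0 1) = 0) ->
  exists (I : set R) (alpha S C : R -> R),
    [/\ is_interval I /\ open I, forall y, B y -> I (y 0 1), smooth_on alpha I,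
        forall v, I v -> is_derive v 1 S (alpha v * sin v) /\ is_derive v 1 C (alpha v * cos v)
      & forall y, B y -> Y1 y = y 0 0 * ch * cos (y 0 1) + sh * S (y 0 1) /\
          Y2 y = y 0 0 * ch * sin (y 0 1) - sh * C (y 0 1)].
Proof.
move=> B epos sh0 C1 C2 D01 D02 D1.
have oB : open B by exact: ball_open.
pose u0 := y0 0 0.
(* The slice u = u0 through the centre of the square, parametrized by v. *)
pose c (t : R) : 'rV[R]_2 := vec2 u0 0 + t *: delta_mx 0 1.
have cE t : c t 0 0 = u0 /\ c t 0 1 = t.
  by rewrite /c !mxE/= mulr0 addr0 mulr1 add0r.
pose I := ball (y0 0 1) e.
have oI : open I by exact: ball_open.
have cB t : I t -> B (c t).
  move=> It; apply/ball_coord => //; have [-> ->] := cE t; by rewrite subrr normr0; split.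
have BI y : B y -> I (y 0 1).
  by move=> /ball_coord-/(_ epos)[_]; rewrite /I -ball_normE.
have Cc k : Ck_on k c I.
  apply: Ck_mx => // i j; rewrite (ord1 i).
  have A : Ck_on k (fun t : R => vec2 u0 0 0 j + t * (delta_mx 0 1 : 'rV[R]_2) 0 j) I.
    apply: (CkD oI); first exact: Ck_cst.
    by apply: (CkM oI); [exact: Ck_id|exact: Ck_cst].
  by apply: Ck_ext A => // t _; rewrite /c !mxE.
pose E0 : 'rV[R]_2 := delta_mx 0 0.
pose E1 : 'rV[R]_2 := delta_mx 0 1.
have dY1 y : B y -> differentiable Y1 y by have /CkSP[+ _] := C1 1; exact.
have dY2 y : B y -> differentiable Y2 y by have /CkSP[+ _] := C2 1; exact.
(* The component of the slice velocity along (- sin t, cos t), hence all of it. *)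
pose lam t := - 'D_E1 Y1 (c t) * sin t + 'D_E1 Y2 (c t) * cos t.
have L1 t : I t -> 'D_E1 Y1 (c t) = - lam t * sin t.
  move=> /cB/D1; have [_ ->] := cE t; rewrite -/E1 /lam; have := cos2Dsin2 t.
  move: ('D_E1 Y1 _) ('D_E1 Y2 _) (cos t) (sin t) => a b x y xy ab.
  have -> : - (- a * y + b * x) * y = a * (x ^+ 2 + y ^+ 2) - x * (a * x + b * y) by ring.
  by rewrite xy ab mulr1 mulr0 subr0.
have L2 t : I t -> 'D_E1 Y2 (c t) = lam t * cos t.
  move=> /cB/D1; have [_ ->] := cE t; rewrite -/E1 /lam; have := cos2Dsin2 t.
  move: ('D_E1 Y1 _) ('D_E1 Y2 _) (cos t) (sin t) => a b x y xy ab.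
  have -> : (- a * y + b * x) * x = b * (x ^+ 2 + y ^+ 2) - y * (a * x + b * y) by ring.
  by rewrite xy ab mulr1 mulr0 subr0.
have Dc1 t : I t -> is_derive t 1 (fun t => Y1 (c t)) (- lam t * sin t).
  by move=> It; rewrite -L1//; apply: is_derive_line; apply: dY1; exact: cB.
have Dc2 t : I t -> is_derive t 1 (fun t => Y2 (c t)) (lam t * cos t).
  by move=> It; rewrite -L2//; apply: is_derive_line; apply: dY2; exact: cB.
have seg (y : 'rV[R]_2) : y = c (y 0 1) + 1 *: ((y 0 0 - u0) *: E0).
  rewrite scale1r; apply: row2P; rewrite /E0 !mxE/=.
    by rewrite mulr0 addr0 mulr1 addrC subrK.
  by rewrite mulr0 addr0 mulr1 add0r.
have line (Y : 'rV[R]_2 -> R) g : (forall y, B y -> differentiable Y y) ->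
    (forall y, B y -> 'D_E0 Y y = g (y 0 1)) ->
    forall y, B y -> Y y = Y (c (y 0 1)) + (y 0 0 - u0) * g (y 0 1).
  move=> dY DY y By.
  have S s : 0 <= s <= 1 -> B (c (y 0 1) + s *: ((y 0 0 - u0) *: E0)).
    move=> s01; have -> : (y 0 0 - u0) *: E0 = y - c (y 0 1).
      have := seg y; rewrite scale1r => Ey.
      by rewrite -[LHS](addKr (c (y 0 1))) -Ey addrC.
    by apply: ball_segment => //; exact/cB/BI.
  have [|s s01] := @MVT_line _ _ Y (c (y 0 1)) ((y 0 0 - u0) *: E0) 1 ltr01.
    by move=> s /S; exact: dY.
  rewrite -(seg y) mul1r => /eqP; rewrite subr_eq addrC => /eqP ->; congr (_ + _).
  have Bs := S s s01.
  rewrite deriveE; last exact: dY.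
  rewrite linearZ/= -deriveE; last exact: dY.
  rewrite DY//; congr (_ * g _).
  by rewrite !mxE/= !(mulr0, mulr1, addr0, add0r).
(* These are forced: the desired formulas on the slice are solved for [S] and [C], and [alpha] comes
   from lam = u0 ch - sh alpha. *)
pose S t := (Y1 (c t) - u0 * ch * cos t) / sh.
pose C t := - (Y2 (c t) - u0 * ch * sin t) / sh.
pose alpha t := (u0 * ch - lam t) / sh.
exists I, alpha, S, C; split=> //.
- split=> //; rewrite /I ball_itv; exact: interval_is_interval.
- move=> k; apply: (CkM oI); last exact: Ck_cst.
  apply: (CkB oI); first exact: Ck_cst.
  have [Ccos Csin] := Ck_cos_sin k oI.
  have CD (Y : 'rV[R]_2 -> R) : smooth_on Y B -> Ck_on k (fun t => 'D_E1 Y (c t)) I.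
    move=> CY; have /CkSP[_ /(_ E1) CY1] := CY k.+1.
    exact: (@Ck_comp _ _ _ k c ('D_E1 Y) I B oI oB cB (Cc k) CY1).
  apply: (CkD oI); apply: (CkM oI) => //; last exact: CD.
  by apply: (CkN oI); exact: CD.
- move=> t It; have D1t := Dc1 t It; have D2t := Dc2 t It; split.
    have -> : S = sh^-1 *: ((fun t => Y1 (c t)) - (u0 * ch) *: cos).
      by apply/funext => s; rewrite /S !fctE mulrC.
    apply: is_derive_eq.
    by rewrite /alpha -[LHS]/(sh^-1 * (- lam t * sin t - (u0 * ch) * (- sin t))); ring.
  have -> : C = - sh^-1 *: ((fun t => Y2 (c t)) - (u0 * ch) *: sin).
    by apply/funext => s; rewrite /C !fctE mulrC mulrN -mulNr.
  apply: is_derive_eq.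
  by rewrite /alpha -[LHS]/(- sh^-1 * (lam t * cos t - (u0 * ch) * cos t)); ring.
- move=> y By; rewrite /S /C; split.
    rewrite (line Y1 (fun t => ch * cos t))//; field.
    by [].
  rewrite (line Y2 (fun t => ch * sin t))//; field.
  by [].
Qed.

End Straighten.

(** The local argument in one chart, after the isometry: [X] is the surface, [N] its unit normal,
    and the constant angle has become the constant height [ch] of [N]. The map [F] is (u, phi) and
    [G] its local inverse. *)
Lemma constant_angle_coordinates (R : realType) (X N : 'rV[R]_2 -> 'rV[R]_3)
    (O : set 'rV[R]_2) (q0 : 'rV[R]_2) (ch sh : R) :
  open O -> O q0 -> smooth_on X O -> smooth_on N O ->
  0 < sh -> ch * ch - sh * sh = 1 ->
  (forall q, O q -> forall v, 'D_v X q = 0 -> v = 0) ->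
  (forall q, O q -> forall v, lorentz ('D_v X q) (N q) = 0) ->
  (forall q, O q -> lorentz (N q) (N q) = -1) ->
  (forall q, O q -> N q 0 ord_max = ch) ->
  (forall q, O q -> exists v w, lorentz ('D_v ('D_w X) q) (N q) != 0) ->
  exists (F G : 'rV[R]_2 -> 'rV[R]_2) (W : set 'rV[R]_2) (y0 : 'rV[R]_2) (e : R)
    (I : set R) (alpha S C : R -> R),
    [/\ [/\ open W, W q0, W `<=` O & smooth_on F W],
        forall q, W q -> ball y0 e (F q) /\ G (F q) = q,
        forall y, ball y0 e y -> W (G y) /\ F (G y) = y,
        smooth_on G (ball y0 e)
      & [/\ is_interval I /\ open I, forall y, ball y0 e y -> I (y 0 1), smooth_on alpha I,
            forall v, I v -> is_derive v 1 S (alpha v * sin v) /\ is_derive v 1 C (alpha v * cos v)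
          & forall y, ball y0 e y ->
              [/\ X (G y) 0 0 = y 0 0 * ch * cos (y 0 1) + sh * S (y 0 1),
                  X (G y) 0 1 = y 0 0 * ch * sin (y 0 1) - sh * C (y 0 1)
                & X (G y) 0 ord_max = - y 0 0 * sh]]].
Proof.
move=> oO Oq0 CX CN sh0 chsh inj nor unit vert II.
have shn : sh != 0 by rewrite gt_eqF.
have CXj j : smooth_on (fun q => X q 0 j) O by move=> k; exact: Ck_coord.
have CNj j : smooth_on (fun q => N q 0 j) O by move=> k; exact: Ck_coord.
have CNs j : smooth_on (fun q => - N q 0 j / sh) O.
  by move=> k; apply: (CkM oO); [apply: (CkN oO); exact: CNj|exact: Ck_cst].
have ab1 q : O q -> (- N q 0 0 / sh) * (- N q 0 0 / sh) + (- N q 0 1 / sh) * (- N q 0 1 / sh) = 1.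
  move=> Oq; have := unit _ Oq; rewrite /lorentz vert// => u.
  have -> : (- N q 0 0 / sh) * (- N q 0 0 / sh) + (- N q 0 1 / sh) * (- N q 0 1 / sh) =
    (N q 0 0 * N q 0 0 + N q 0 1 * N q 0 1) / (sh * sh) by field.
  have -> : N q 0 0 * N q 0 0 + N q 0 1 * N q 0 1 = sh * sh by lra.
  by rewrite divff// mulf_neq0.
have [Q [phi [oQ Qq0 QO Cphi ang]]] := local_angle oO Oq0 (CNs 0) (CNs 1) ab1.
have N0 q : Q q -> N q 0 0 = - sh * cos (phi q).
  by move=> /ang[<- _]; field.
have N1 q : Q q -> N q 0 1 = - sh * sin (phi q).
  by move=> /ang[_ <-]; field.
have dphi q : Q q -> differentiable phi q by have /CkSP[+ _] := Cphi 1; exact.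
have dX q : O q -> differentiable X q by have /CkSP[+ _] := CX 1; exact.
have dXj j q : O q -> differentiable (fun q => X q 0 j) q by have /CkSP[+ _] := CXj j 1; exact.
have dNj j q : O q -> differentiable (fun q => N q 0 j) q by have /CkSP[+ _] := CNj j 1; exact.
have ddX w q : O q -> differentiable ('D_w X) q.
  by have /CkSP[_ /(_ w)] := CX 2; move=> /CkSP[+ _]; exact.
have ddXj w j q : O q -> differentiable ('D_w (fun q => X q 0 j)) q.
  by have /CkSP[_ /(_ w)] := CXj j 2; move=> /CkSP[+ _]; exact.
have DXE v q j : O q -> 'D_v X q 0 j = 'D_v (fun q => X q 0 j) q.
  by move=> Oq; apply: derive_coord; exact: dX.
have DDXE v w q j : O q -> 'D_v ('D_w X) q 0 j = 'D_v ('D_w (fun q => X q 0 j)) q.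
  move=> Oq; apply: (etrans (derive_coord _ _ _ (ddX w q Oq))).
  apply: near_eq_derive.
  have nO : nbhs q O by exact: open_nbhs_nbhs.
  by apply: filterS nO => r Or; exact: DXE.
pose u q := - X q 0 ord_max / sh.
(* The 1-form lambda: the component of dX(v) along e'. *)
pose lam v q := - 'D_v (fun q => X q 0 0) q * sin (phi q) + 'D_v (fun q => X q 0 1) q * cos (phi q).
have Cu : smooth_on u O.
  by move=> k; apply: (CkM oO); [apply: (CkN oO); exact: CXj|exact: Ck_cst].
have Du v q : O q -> 'D_v (fun q => X q 0 ord_max) q = - sh * 'D_v u q.
  move=> Oq; have du : differentiable u q by have /CkSP[+ _] := Cu 1; exact.
  have -> : (fun q => X q 0 ord_max) = (- sh) *: u.
    by apply/funext => r; rewrite /u !fctE -[RHS]/(- sh * (- X r 0 ord_max / sh)); field.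
  by rewrite deriveZ//; exact: diff_derivable.
(* [N] is - sh e plus ch times the vertical unit vector, and the height of [X] has differential - sh
   du, so orthogonality fixes the component of dX along e. *)
have rad v q : Q q -> 'D_v (fun q => X q 0 0) q * cos (phi q) +
    'D_v (fun q => X q 0 1) q * sin (phi q) = ch * 'D_v u q.
  move=> Qq; have Oq := QO _ Qq.
  have := nor _ Oq v; rewrite /lorentz !DXE// N0// N1// vert// Du// => E.
  apply: (mulfI shn); apply/eqP; rewrite -subr_eq0; apply/eqP.
  by rewrite -[RHS]oppr0 -[in RHS]E; ring.
have IIE v w q : Q q -> lorentz ('D_v ('D_w X) q) (N q) = sh * ('D_v phi q * lam w q).
  move=> Qq; have Oq := QO _ Qq.
  have nQ : nbhs q Q by exact: open_nbhs_nbhs.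
  have nO : nbhs q O by exact: open_nbhs_nbhs.
  pose a j r := 'D_w (fun q => X q 0 j) r.
  pose n j r := N r 0 j.
  have da j : is_derive q v (a j) ('D_v ('D_w X) q 0 j).
    rewrite (DDXE v w q j Oq); apply: derivableP; apply: diff_derivable; exact: ddXj.
  have [dc ds] := is_derive_cos_comp v (dphi q Qq).
  have dn0 : is_derive q v (n 0) (- sh *: (- sin (phi q) * 'D_v phi q)).
    have nE : \forall r \near q, - sh * cos (phi r) = n 0 r.
      by apply: filterS nQ => r Qr; rewrite /n N0.
    exact: (near_eq_is_derive nE (is_deriveZ (- sh) dc)).
  have dn1 : is_derive q v (n 1) (- sh *: (cos (phi q) * 'D_v phi q)).
    have nE : \forall r \near q, - sh * sin (phi r) = n 1 r.
      by apply: filterS nQ => r Qr; rewrite /n N1.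
    exact: (near_eq_is_derive nE (is_deriveZ (- sh) ds)).
  have dn2 : is_derive q v (n ord_max) 0.
    have nE : \forall r \near q, ch = n ord_max r.
      by apply: filterS nO => r Or; rewrite /n vert.
    exact: (near_eq_is_derive nE (is_derive_cst ch q v)).
  (* The derivative along [v] of the pairing of ['D_w X] with [N] is computed twice: the pairing
     vanishes near [q], and the product rule expands it. *)
  have g0 : is_derive q v (a 0 * n 0 + a 1 * n 1 - a ord_max * n ord_max) 0.
    have nE : \forall r \near q, 0 = (a 0 * n 0 + a 1 * n 1 - a ord_max * n ord_max) r.
      by apply: filterS nO => r Or; rewrite -(nor _ Or w) /lorentz !DXE.
    exact: (near_eq_is_derive nE (is_derive_cst 0 q v)).
  have g1 := is_deriveB (is_deriveD (is_deriveM (da 0) dn0) (is_deriveM (da 1) dn1))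
    (is_deriveM (da ord_max) dn2).
  have := @derive_val _ _ _ _ _ _ _ g1; rewrite (@derive_val _ _ _ _ _ _ _ g0).
  rewrite /lorentz /lam -/(a 0 q) -/(a 1 q) -/(n 0 q) -/(n 1 q) -/(n ord_max q).
  move: ('D_v ('D_w X) q 0 0) ('D_v ('D_w X) q 0 1) ('D_v ('D_w X) q 0 ord_max) => A0 A1 A2.
  move: (a 0 q) (a 1 q) (a ord_max q) (n 0 q) (n 1 q) (n ord_max q) => a0 a1 a2 n0 n1 n2.
  move: ('D_v phi q) (cos _) (sin _) => p x y E.
  have {}E : 0 = a0 * (- sh * (- y * p)) + n0 * A0 + (a1 * (- sh * (x * p)) + n1 * A1)
    - (a2 * 0 + n2 * A2) by exact: E.
  by rewrite -[LHS]subr0 E; ring.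
have sym v w q : Q q -> 'D_v phi q * lam w q = 'D_w phi q * lam v q.
  move=> Qq; have Oq := QO _ Qq; apply: (mulfI shn).
  have E : 'D_v ('D_w X) q = 'D_w ('D_v X) q.
    apply/rowP => j; apply: (etrans (DDXE v w q j Oq)); apply/esym.
    apply: (etrans (DDXE w v q j Oq)).
    exact: (derive_symmetric w v oO (CXj j 2) Oq).
  by apply: (etrans (esym (IIE v w q Qq))); rewrite E; exact: IIE.
have nz q : Q q -> exists v, 'D_v phi q != 0.
  move=> Qq; have [v [w]] := II _ (QO _ Qq); rewrite IIE//.
  by rewrite !mulf_eq0 !negb_or => /and3P[_ Dv _]; exists v.
(* For [w] with dphi(w) nonzero, symmetry gives dphi(w) lam(v) = dphi(v) lam(w) = 0. *)
have lam0 v q : Q q -> 'D_v phi q = 0 -> lam v q = 0.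
  move=> Qq Dv; have [w Dw] := nz _ Qq.
  by have /eqP := sym w v q Qq; rewrite Dv mul0r mulf_eq0 (negPf Dw)/= => /eqP.
have X0 v q : Q q -> 'D_v (fun q => X q 0 0) q = ch * 'D_v u q * cos (phi q) - lam v q * sin (phi q).
  move=> /(rad v) <-; rewrite /lam; have := cos2Dsin2 (phi q).
  move: ('D_v _ _) ('D_v _ _) (cos _) (sin _) => a b x y xy.
  by rewrite -[LHS]mulr1 -xy; ring.
have X1 v q : Q q -> 'D_v (fun q => X q 0 1) q = ch * 'D_v u q * sin (phi q) + lam v q * cos (phi q).
  move=> /(rad v) <-; rewrite /lam; have := cos2Dsin2 (phi q).
  move: ('D_v _ _) ('D_v _ _) (cos _) (sin _) => a b x y xy.
  by rewrite -[LHS]mulr1 -xy; ring.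
pose F q := vec2 (u q) (phi q).
have F0 q : F q 0 0 = u q by rewrite (vec2E _ _).1.
have F1 q : F q 0 1 = phi q by rewrite (vec2E _ _).2.
have CF : smooth_on F Q.
  move=> k; apply: Ck_mx => // i j; rewrite (ord1 i) /F.
  have -> : (fun q => vec2 (u q) (phi q) 0 j) = if j == 0 then u else phi.
    by apply/funext => q; rewrite mxE; case: ifP.
  by case: ifP => _; [exact: Ck_sub (Cu k)|exact: Cphi].
have dF q : Q q -> differentiable F q by have /CkSP[+ _] := CF 1; exact.
have F0u : (fun q => F q 0 0) = u by apply/funext.
have F1phi : (fun q => F q 0 1) = phi by apply/funext.
have DF0 v q : Q q -> 'D_v F q 0 0 = 'D_v u q.
  by move=> /dF Fq; rewrite derive_coord// F0u.
have DF1 v q : Q q -> 'D_v F q 0 1 = 'D_v phi q.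
  by move=> /dF Fq; rewrite derive_coord// F1phi.
have injF v : 'D_v F q0 = 0 -> v = 0.
  move=> Fv; apply: (inj _ Oq0).
  have Dv : 'D_v u q0 = 0 by rewrite -DF0// Fv mxE.
  have Dp : 'D_v phi q0 = 0 by rewrite -DF1// Fv mxE.
  have lv := lam0 _ _ Qq0 Dp.
  apply: row3P; rewrite DXE// mxE.
  - by rewrite X0// Dv lv; ring.
  - by rewrite X1// Dv lv; ring.
  - by rewrite Du// Dv mulr0.
have [W [e [G [[e0 oW Wq0 WQ] WF BG CG]]]] := inverse_function oQ Qq0 CF injF.
pose y0 := F q0; pose B := ball y0 e.
have oB : open B by exact: ball_open.
have dG y : B y -> differentiable G y by have /CkSP[+ _] := CG 1; exact.
have BQ y : B y -> Q (G y) by move=> /BG[/WQ].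
have BO y : B y -> O (G y) by move=> /BQ/QO.
have phiG y : B y -> phi (G y) = y 0 1 by move=> /BG[_ E]; rewrite -F1 E.
have uG y : B y -> u (G y) = y 0 0 by move=> /BG[_ E]; rewrite -F0 E.
have chain (f : 'rV[R]_2 -> R) w y : B y -> differentiable f (G y) ->
    'D_w (fun y => f (G y)) y = 'D_('D_w G y) f (G y).
  move=> By df; rewrite deriveE; last by apply: differentiable_comp => //; exact: dG.
  by rewrite (@diff_comp _ _ _ _ G f)//=; [rewrite -!deriveE//; exact: dG|exact: dG].
(* [F] after [G] is the identity near [y]; hence du and dphi of the image of [w] under the
   differential of [G] are the two coordinates of [w]. *)
have FG w y : B y -> 'D_('D_w G y) F (G y) = w.
  move=> By; have dFy := dF _ (BQ _ By).
  rewrite deriveE// deriveE; last exact: dG.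
  rewrite -[LHS]/(('d F (G y) \o 'd G y) w) -diff_comp//; last exact: dG.
  rewrite -deriveE; last by apply: differentiable_comp => //; exact: dG.
  rewrite -[RHS](derive_id y w); apply: near_eq_derive.
  have nB : nbhs y B by exact: open_nbhs_nbhs.
  by apply: filterS nB => z /BG[].
pose Y j y := X (G y) 0 j.
have CY j : smooth_on (Y j) B.
  by move=> k; exact: (@Ck_comp _ _ _ k G (fun q => X q 0 j) B O oB oO BO (CG k) (CXj j k)).
pose E0 : 'rV[R]_2 := delta_mx 0 0.
pose E1 : 'rV[R]_2 := delta_mx 0 1.
have DY j w y : B y -> 'D_w (Y j) y = 'D_('D_w G y) (fun q => X q 0 j) (G y).
  by move=> By; rewrite -chain//; exact/dXj/BO.
have Ru w y : B y -> 'D_('D_w G y) u (G y) = w 0 0.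
  by move=> By; rewrite -DF0 ?FG//; exact: BQ.
have Rphi w y : B y -> 'D_('D_w G y) phi (G y) = w 0 1.
  by move=> By; rewrite -DF1 ?FG//; exact: BQ.
(* The u-direction lies in the kernel of dphi, so lambda vanishes on it: this is why [X] has no e'
   component of velocity along the u-lines. *)
have l0 y : B y -> lam ('D_E0 G y) (G y) = 0.
  by move=> By; apply: lam0; [exact: BQ|rewrite Rphi// mxE].
have [|||I [alpha [S [C [HI BI Ca DSC YE]]]]] :=
  @straighten _ (Y 0) (Y 1) y0 e ch sh e0 shn (CY 0) (CY 1).
- move=> y By; rewrite DY// X0; last exact: BQ.
  by rewrite l0// Ru// phiG// /E0 mxE/=; ring.
- move=> y By; rewrite DY// X1; last exact: BQ.
  by rewrite l0// Ru// phiG// /E0 mxE/=; ring.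
- move=> y By; rewrite !DY// X0; last exact: BQ.
  rewrite X1; last exact: BQ.
  by rewrite Ru// phiG// /E1 mxE/=; ring.
exists F, G, W, y0, e, I, alpha, S, C; split=> //.
- split=> //; first by move=> q /WQ/QO.
  by move=> k; exact: Ck_sub (CF k).
- split=> // y By; have [Y0 Y1] := YE y By; split=> //.
  by have := uG y By; rewrite /u => <-; field.
Qed.

(** * Change of coordinates on a surface *)

Lemma open_preimage_in (T U : topologicalType) (f : T -> U) (D : set T) (E : set U) :
  open D -> {in D, continuous f} -> open E -> open (D `&` f @^-1` E).
Proof.
move=> oD cf oE; rewrite openE => q [Dq Eq].
have nD : nbhs q D by exact: open_nbhs_nbhs.
have nE : nbhs (f q) E by exact: open_nbhs_nbhs.
have cq : {for q, continuous f} by apply: cf; rewrite inE.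
exact: (filterI nD (cq _ nE)).
Qed.

(** The chart [c] is restricted to the points it sends into [W] and followed by [F]. Its transitions
    with the atlas are those of [c] composed with [G] or [F], hence smooth, which places it in the
    maximal atlas. *)
Lemma reparam_chart (R : realType) (M : topologicalType) (atlas : set (chart R M))
    (c : chart R M) (F G : 'rV[R]_2 -> 'rV[R]_2) (W B : set 'rV[R]_2) :
  (forall d, atlas d -> compatible c d) ->
  open W -> W `<=` chart_cod c -> open B -> smooth_on F W -> smooth_on G B ->
  (forall q, W q -> B (F q) /\ G (F q) = q) ->
  (forall y, B y -> W (G y) /\ F (G y) = y) ->
  exists c' : chart R M, [/\ maximal_atlas atlas c',
    chart_dom c' = chart_dom c `&` chart_map c @^-1` W,
    chart_cod c' = B & chart_inv c' = chart_inv c \o G].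
Proof.
move=> comp oW WO oB CF CG WF BG.
pose dom := chart_dom c `&` chart_map c @^-1` W.
pose map p := F (chart_map c p).
pose inv := chart_inv c \o G.
have dom_open : open dom.
  exact: open_preimage_in (@chart_dom_open _ _ c) (@chart_map_continuous _ _ c) oW.
have map_cod p : dom p -> B (map p) by move=> [_ /WF[]].
have inv_dom q : B q -> dom (inv q).
  move=> /BG[Wq _]; split; first exact/chart_inv_dom/WO.
  by rewrite /inv /= chart_invK//; exact: WO.
have mapK p : dom p -> inv (map p) = p.
  by move=> [dp /WF[_ E]]; rewrite /inv /= E chart_mapK.
have invK q : B q -> map (inv q) = q.
  by move=> /BG[Wq E]; rewrite /map /inv /= chart_invK//; exact: WO.
have map_cont : {in dom, continuous map}.
  move=> p /set_mem[dp Wp]; apply: continuous_comp.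
    by apply: chart_map_continuous; rewrite inE.
  by apply: (CF 0%N); rewrite inE.
have inv_cont : {in B, continuous inv}.
  move=> q Bq; apply: continuous_comp; first exact: (CG 0%N).
  by apply: chart_inv_continuous; rewrite inE; apply: WO; have [] := BG _ (set_mem Bq).
exists (Chart dom_open oB map_cod inv_dom mapK invK map_cont inv_cont).
split=> // d ad; have [cd dc] := comp d ad; split=> k.
  have oD : open (B `&` inv @^-1` chart_dom d).
    exact: open_preimage_in oB inv_cont (@chart_dom_open _ _ d).
  have oE : open (chart_cod c `&` chart_inv c @^-1` chart_dom d).
    exact: open_preimage_in (@chart_cod_open _ _ c) (@chart_inv_continuous _ _ c) (@chart_dom_open _ _ d).
  apply: (@Ck_comp_mx _ _ _ _ _ k G (chart_map d \o chart_inv c) _ _ oD oE).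
  - by move=> q [/BG[/WO Wq _]].
  - by apply: Ck_sub (CG k) => q [].
  - exact: cd.
have oD : open (chart_cod d `&` chart_inv d @^-1` dom).
  exact: open_preimage_in (@chart_cod_open _ _ d) (@chart_inv_continuous _ _ d) dom_open.
apply: (@Ck_comp_mx _ _ _ _ _ k (chart_map c \o chart_inv d) F _ _ oD oW).
- by move=> q [_ [_ ]].
- by apply: Ck_sub (dc k) => q [? []].
- exact: CF.
Qed.

(** * Hyperbolic identities, unit timelike vectors and the classification *)

Lemma sinhR_gt0 (R : realType) (t : R) : 0 < t -> 0 < sinhR t.
Proof. by move=> t0; rewrite divr_gt0// subr_gt0 ltr_expR; lra. Qed.

Lemma coshR2_sinhR2 (R : realType) (t : R) : coshR t * coshR t - sinhR t * sinhR t = 1.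
Proof.
have := expRxMexpNx_1 t; rewrite /coshR /sinhR.
move: (expR t) (expR (- t)) => a b ab.
have -> : (a + b) / 2 * ((a + b) / 2) - (a - b) / 2 * ((a - b) / 2) = a * b by field.
exact: ab.
Qed.

Lemma lorentz_vertical (R : realType) (w : 'rV[R]_3) : lorentz w (pt 0 1) = - w 0 ord_max.
Proof. by rewrite /lorentz; have [-> -> ->] := ptE (0 : 'rV[R]_2) 1; rewrite !mxE; ring. Qed.

Lemma timelike_norm1 (R : realType) (w : 'rV[R]_3) :
  timelike w -> lorentz_norm w = 1 -> lorentz w w = -1.
Proof.
rewrite /timelike /lorentz_norm => w0 w1.
have := sqr_sqrtr (normr_ge0 (lorentz w w)).
by rewrite w1 ltr0_norm// expr1n => ->; rewrite opprK.
Qed.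

Theorem theorem3p4 (R : realType) (M : topologicalType)
    (atlas : set (chart R M)) (x xi : M -> 'rV[R]_3)
    (U : 'rV[R]_3) (theta : R)
    (hM : smooth_surface atlas)
    (hconn : connected [set: M])
    (himm : immersion atlas x)
    (hspace : spacelike atlas x)
    (hxi : future_unit_normal atlas x xi)
    (hU : future_directed U)
    (hU1 : lorentz_norm U = 1)
    (htheta : 0 < theta)
    (hangle : constant_angle xi U theta)
    (hII : second_fundamental_form_nowhere_zero atlas x xi) :
  exists (A : 'M[R]_3) (b : 'rV[R]_3),
    [/\ lorentz_linear_isometry A,
        U *m A = pt 0 1
      & forall p : M,
        exists c : chart R M,
          [/\ maximal_atlas atlas c,
              chart_dom c p
            & exists (I : set R) (alpha S C : R -> R),
              [/\ is_interval I /\ open I,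
                  forall q, chart_cod c q -> I (q 0 1),
                  smooth_on alpha I,
                  forall v, I v ->
                    is_derive v 1 S (alpha v * sin v) /\
                    is_derive v 1 C (alpha v * cos v)
                & forall q, chart_cod c q ->
                    x (chart_inv c q) *m A + b =
                    constant_angle_param theta S C (q 0 0) (q 0 1)]]].
Proof.
have [_ _ cover compat] := hM.
have [Cx _] := himm.
have [Cxi nor unit _] := hxi.
have [tU fU] := hU.
have U1 := timelike_norm1 tU hU1.
have [A isoA UA] := lorentz_isometry_to_vertical U1 fU.
(* [A] depends on [U] alone, so it serves all points at once. The translation is zero: a horizontal
   one is absorbed by the integration constants of [S] and [C], a vertical one by u, which is read
   off the height. *)
exists A, 0; split=> // p.
have [c ac cp] := cover p.
pose O := chart_cod c.
have oO : open O by exact: chart_cod_open.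
pose q0 := chart_map c p.
have Oq0 : O q0 by exact: chart_map_cod.
pose x' := x \o chart_inv c.
pose X q := x' q *m A.
pose N q := xi (chart_inv c q) *m A.
have Cx' k : Ck_on k x' O by exact: Cx.
have CX : smooth_on X O by move=> k; exact: Ck_mulmxr.
have CN : smooth_on N O by move=> k; apply: Ck_mulmxr => //; exact: Cxi.
have cA : continuous (mulmxr A : 'rV[R]_3 -> 'rV[R]_3) by exact: continuous_mulmxr.
have dx q : O q -> differentiable x' q by have /CkSP[+ _] := Cx' 1%N; exact.
have DX v q : O q -> 'D_v X q = 'D_v x' q *m A.
  by move=> Oq; exact: (derive_linear_comp v cA (dx q Oq)).
have DDX v w q : O q -> 'D_v ('D_w X) q = 'D_v ('D_w x') q *m A.
  move=> Oq; have /CkSP[_ /(_ w)/CkSP[/(_ q Oq) ddx _]] := Cx' 2%N.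
  apply: (etrans _ (derive_linear_comp v cA ddx)); apply: near_eq_derive.
  have nO : nbhs q O by exact: open_nbhs_nbhs.
  by apply: filterS nO => r Or; exact: DX.
have [||||| F [G [W [y0 [e [I [alpha [S [C [[oW Wq0 WO CF] WF BG CG [HI BI Ca DSC XE]]]]]]]]]]] :=
  constant_angle_coordinates oO Oq0 CX CN (sinhR_gt0 htheta) (coshR2_sinhR2 theta).
(* Spacelikeness gives the image of a nonzero vector a positive square, so the image cannot be
   zero. *)
- move=> q Oq v; rewrite DX// => E; have [//|v0] := eqVneq v 0.
  by have := hspace c ac q Oq v v0; rewrite -isoA E /lorentz !mxE !mul0r addr0 subr0 ltxx.
- by move=> q Oq v; rewrite DX// isoA; exact: nor.
- by move=> q Oq; rewrite isoA; exact: unit.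
(* Both vectors being unit, the angle condition reads <xi, U> = - cosh(theta), and the isometry
   turns the left side into minus the height of [N]. *)
- move=> q Oq; have [_ _ _ _] := hangle (chart_inv c q).
  rewrite -isoA UA lorentz_vertical hU1 /lorentz_norm unit normrN1 sqrtr1 !mul1r.
  by move/oppr_inj.
(* The pairing is, up to sign, the coefficient of xi in the second fundamental form. *)
- move=> q Oq; have [v [w IIvw]] := hII c ac q Oq; exists v, w; rewrite DDX// isoA.
  apply: contraNneq IIvw => E.
  by rewrite /second_fundamental_form E oppr0 scale0r.
have oB : open (ball y0 e) by exact: ball_open.
have [c' [mc' dom' cod' inv']] := reparam_chart (fun d => compat c d ac) oW WO oB CF CG WF BG.
exists c'; split=> //; first by rewrite dom'; split.
exists I, alpha, S, C; rewrite cod' inv'; split=> // q Bq; rewrite addr0.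
have [X0 X1 X2] := XE q Bq.
have [P0 P1 P2] := ptE ((q 0 0 * coshR theta) *: vec2 (cos (q 0 1)) (sin (q 0 1)) + psi theta S C (q 0 1))
  (- q 0 0 * sinhR theta).
rewrite /constant_angle_param; apply: row3P.
- by rewrite P0 -[LHS]/(X (G q) 0 0) X0 /psi !mxE/=; ring.
- by rewrite P1 -[LHS]/(X (G q) 0 1) X1 /psi !mxE/=; ring.
- by rewrite P2 -[LHS]/(X (G q) 0 ord_max) X2.
Qed.
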